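(* Let $N,M\in\mathbb{N}$ be such that $2<M\le\frac N2$. Let $0=a_0<a_1<\dots<a_{M-1}$ be integers with $a_{M-1}\le N-1$, and let $\mathcal{I}_M=\bigcup_{k=0}^{M-1}[a_k,a_k+1)\subset[0,N)$. Let $u\in\mathbb{N}$ satisfy $$u>\begin{cases}\frac N\pi\cos^{-1}\left(M\sin\frac1M\right) & \text{if } N \text{ is even},\\[2pt] \frac N\pi\cos^{-1}\left(M\sin\frac1M\cos\frac{\pi}{2N}\right)-\frac12 & \text{if } N\text{ is odd}.\end{cases}$$ If all distinct $a_k$ and $a_{k'}$ satisfy $$\min_{m\in\mathbb{Z}}\left|\frac{a_k-a_{k'}}{N}-m\right|-\min_{m\in\mathbb{Z}}\left|\frac{(a_k-a_{k'})M}{N}-m\right|>\frac uN,$$ then $$\mathcal{B}_M=\bigcup_{j=1}^{M}\left\{e^{2\pi i\left(n+\frac{j-1}{N}\right)x}\right\}_{n\in\mathbb{Z}}$$ is a (Riesz) basis for $L^2(\mathcal{I}_M)$ with Riesz constants $A,B$ satisfying $$M\left(1-\left|\cos\frac{\pi u}{N}\right|\right)\le A\quad\text{and}\quad B\le M\left(1+\left|\cos\frac{\pi u}{N}\right|\right)\qquad\text{if } N\text{ is even},$$ $$M\left(1-\left|\frac{\cos\left(\frac{\pi}{2N}+\frac{\pi u}{N}\right)}{\cos\frac{\pi}{2N}}\right|\right)\le A\quad\text{and}\quad B\le M\left(1+\left|\frac{\cos\left(\frac{\pi}{2N}+\frac{\pi u}{N}\right)}{\cos\frac{\pi}{2N}}\right|\right)\qquad\text{if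 } N\text{ is odd}.$$
   Context: $\mathbb{N}=\{1,2,3,\dots\}$. A sequence $\{v_j\}$ in a separable Hilbert space $H$ is a Riesz basis with Riesz (frame) constants $A,B>0$ if for every finite family of complex scalars $\{c_j\}_{j\in J}$ one has $A\sum_{j\in J}|c_j|^2\le\|\sum_{j\in J}c_jv_j\|^2\le B\sum_{j\in J}|c_j|^2$, and for every $w\in H$ one has $A\|w\|^2\le\sum_j|\langle w,v_j\rangle|^2\le B\|w\|^2$. For a measurable $D\subset\mathbb{R}$, $\|f\|_{L^2(D)}^2=\int_D|f(x)|^2dx$, and exponentials are regarded as elements of $L^2(D)$ by restriction to $D$. ''Basis'' for a system of exponentials means Riesz basis. *)

(* Defs.v *)
From HB Require Import structures.
From mathcomp Require Import all_boot all_order all_algebra finmap complex.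
From mathcomp Require Import all_classical all_reals all_analysis.
Import Order.TTheory GRing.Theory Num.Theory.
Import numFieldNormedType.Exports.
Import ComplexField.Normc.

Set Implicit Arguments.
Unset Strict Implicit.
Unset Printing Implicit Defensive.

Local Open Scope classical_set_scope.
Local Open Scope ring_scope.

Definition ip_normsq (R : realType) (V : lmodType R[i])
    (ip : V -> V -> R[i]) (w : V) : R :=
  complex.Re (ip w w).

(* [H] is the set of vectors of the Hilbert space and [ip] its inner product,
   linear in the first argument. A vector may be given by a representative: the
   definition only depends on vectors modulo those of norm 0, as is needed for
   L^2 spaces. *)
Definition riesz_basis (R : realType) (V : lmodType R[i]) (H : set V)
    (ip : V -> V -> R[i]) (I : choiceType) (v : I -> V) (A B : R) : Prop :=
  [/\ 0 < A, 0 < B,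
      (forall j, H (v j)),
      (forall (J : {fset I}) (c : I -> R[i]),
        A * (\sum_(j <- J) normc (c j) ^+ 2)
          <= ip_normsq ip (\sum_(j <- J) c j *: v j)
          <= B * (\sum_(j <- J) normc (c j) ^+ 2)) &
      (forall w, H w ->
        ((A * ip_normsq ip w)%:E
           <= \esum_(j in [set: I]) (normc (ip w (v j)) ^+ 2)%:E
           <= (B * ip_normsq ip w)%:E)%E)].

(* Functions take values in [R[i]^o], that is, in R[i] viewed as a module over
   itself, so that they form a complex vector space. *)
Definition cintegral (R : realType) (D : set R) (f : R -> R[i]^o) : R[i] :=
  Complex (\int[@lebesgue_measure R]_(x in D) complex.Re (f x))
          (\int[@lebesgue_measure R]_(x in D) complex.Im (f x)).

Definition L2 (R : realType) (D : set R) : set (R -> R[i]^o) :=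
  [set f : R -> R[i]^o |
    [/\ measurable_fun D (fun x : R => complex.Re (f x) : R),
        measurable_fun D (fun x : R => complex.Im (f x) : R) &
        (\int[@lebesgue_measure R]_(x in D) (normc (f x) ^+ 2)%:E < +oo)%E]].

Definition L2_ip (R : realType) (D : set R) (f g : R -> R[i]^o) : R[i] :=
  cintegral D (fun x => f x * conjc (g x)).

(* x |-> exp (2 pi i lambda x) *)
Definition expo (R : realType) (lambda : R) : R -> R[i]^o := fun x =>
  Complex (cos (2 * pi * lambda * x)) (sin (2 * pi * lambda * x)).

(* The index set of the system is [{0, ..., M - 1}] x Z; the frequencies
   n + j / N are pairwise distinct for M <= N. *)
Definition exp_system (R : realType) (N M : nat) (p : 'I_M * int) :
    R -> R[i]^o :=
  expo (p.2%:~R + (p.1 : nat)%:R / N%:R).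

(* The infimum is attained: it is the minimum over the integers m. *)
Definition dist_int (R : realType) (x : R) : R :=
  inf [set `|x - m%:~R| | m in [set: int]].

Definition unit_intervals (R : realType) (M : nat) (a : nat -> int) : set R :=
  \bigcup_(k < M) `[(a k)%:~R, (a k)%:~R + 1[%classic.

Arguments exp_system : clear implicits.
Arguments unit_intervals : clear implicits.

(* Main.v *)
(* The proof is Gershgorin's argument for a Gram matrix of exponentials.
   Cutting L^2(D) into its M unit intervals turns a vector w of L^2(D) into the
   C^M-valued function x |-> (w(x + a_k))_k on [0, 1). By Parseval on [0, 1),
   the sum of |<w, v_(j,n)>|^2 over n and j is the integral of the squared norm
   of G (w(x + a_k))_k, where G is the M x M matrix with entries
   exp(-2 pi i j a_k / N). Dually, the norm of a finite combination of the
   system is the integral of the squared norm of G^* applied to M trigonometric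
   polynomials. So both requirements for a Riesz basis reduce to
     A |z|^2 <= |G z|^2 <= B |z|^2 on C^M,
   which passes from G to G^* because G is square. The columns of G have squared
   norm M and their inner products are Dirichlet kernels
   sin(pi M t) / sin(pi t) at t = (a_k - a_k') / N, whose modulus the separation
   hypothesis bounds by rho := cos(pi u / N) (by
   cos(pi / 2N + pi u / N) / cos(pi / 2N) for odd N). Hence A = M (1 - rho) and
   B = M (1 + rho) will do, and rho < 1 already because u > 0.

   Parseval on [0, 1) needs the density of the trigonometric polynomials in L^2.
   The indicator function of an arc of the circle is {cos(2 pi (x - c)) > s},
   hence a bounded limit of polynomials in this cosine; Dynkin's lemma gives all
   measurable sets, and simple functions the rest. *)

From HB Require Import structures.
Require Import Defs.
From mathcomp Require Import all_boot all_order all_algebra finmap complex.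
From mathcomp Require Import all_classical all_reals all_analysis.
From mathcomp Require Import measurable_realfun ring lra zify.
Import Order.TTheory GRing.Theory Num.Theory.
Import numFieldNormedType.Exports.
Import ComplexField.Normc.
Local Open Scope ring_scope.
Set Implicit Arguments.
Unset Strict Implicit.
Unset Printing Implicit Defensive.

(** * Complex-valued square-integrable functions *)

Section ComplexNumbers.
Variable R : realType.
Implicit Types (z w : R[i]).

Lemma normc_sqr z : normc z ^+ 2 = complex.Re z ^+ 2 + complex.Im z ^+ 2.
Proof. by case: z => a b /=; rewrite sqr_sqrtr// addr_ge0// sqr_ge0. Qed.

Lemma complex_ext z w :
  complex.Re z = complex.Re w -> complex.Im z = complex.Im w -> z = w.
Proof. by case: z w => [a b] [c d] /= -> ->. Qed.

Lemma ReD z w : complex.Re (z + w) = complex.Re z + complex.Re w.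
Proof. by case: z w => [a b] [c d]. Qed.

Lemma ImD z w : complex.Im (z + w) = complex.Im z + complex.Im w.
Proof. by case: z w => [a b] [c d]. Qed.

Lemma ReM z w : complex.Re (z * w) =
  complex.Re z * complex.Re w - complex.Im z * complex.Im w.
Proof. by case: z w => [a b] [c d]. Qed.

Lemma ImM z w : complex.Im (z * w) =
  complex.Re z * complex.Im w + complex.Im z * complex.Re w.
Proof. by case: z w => [a b] [c d]. Qed.

Lemma Re_conjc z : complex.Re (conjc z) = complex.Re z.
Proof. by case: z. Qed.

Lemma Im_conjc z : complex.Im (conjc z) = - complex.Im z.
Proof. by case: z. Qed.

Lemma ReN z : complex.Re (- z) = - complex.Re z.
Proof. by case: z. Qed.

Lemma ImN z : complex.Im (- z) = - complex.Im z.
Proof. by case: z. Qed.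

Lemma Re_sum I (s : seq I) (P : pred I) (F : I -> R[i]) :
  complex.Re (\sum_(i <- s | P i) F i) = \sum_(i <- s | P i) complex.Re (F i).
Proof. by elim/big_rec2 : _ => // i x y _ <-; rewrite ReD. Qed.

Lemma Im_sum I (s : seq I) (P : pred I) (F : I -> R[i]) :
  complex.Im (\sum_(i <- s | P i) F i) = \sum_(i <- s | P i) complex.Im (F i).
Proof. by elim/big_rec2 : _ => // i x y _ <-; rewrite ImD. Qed.

Lemma mulc_conj z : z * conjc z = Complex (normc z ^+ 2) 0.
Proof. by apply: complex_ext; rewrite ?ReM ?ImM Re_conjc Im_conjc normc_sqr/=; ring. Qed.

Lemma normc_conj z : normc (conjc z) = normc z.
Proof. by case: z => a b /=; rewrite sqrrN. Qed.

Lemma normc_ge0 z : 0 <= normc z.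
Proof. by case: z => a b /=; rewrite sqrtr_ge0. Qed.

Lemma le_Re_normc z : `|complex.Re z| <= normc z.
Proof.
by case: z => a b /=; rewrite -sqrtr_sqr ler_wsqrtr// lerDl sqr_ge0.
Qed.

Lemma le_Im_normc z : `|complex.Im z| <= normc z.
Proof.
by case: z => a b /=; rewrite -sqrtr_sqr ler_wsqrtr// lerDr sqr_ge0.
Qed.

Lemma le_normc_sum I (s : seq I) (P : pred I) (F : I -> R[i]) :
  normc (\sum_(i <- s | P i) F i) <= \sum_(i <- s | P i) normc (F i).
Proof.
elim/big_rec2 : _ => [|i x y _ h]; first by rewrite ComplexField.Normc.normc0.
by apply: le_trans (le_normcD _ _) _; rewrite lerD2l.
Qed.

(** Half of the parallelogram law. It replaces the triangle inequality throughout, so that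
    approximation is measured by squared norms without square roots. *)
Lemma normc_sqrD_le z w :
  normc (z + w) ^+ 2 <= 2 * normc z ^+ 2 + 2 * normc w ^+ 2.
Proof. rewrite !normc_sqr ReD ImD.
have := sqr_ge0 (complex.Re z - complex.Re w).
have := sqr_ge0 (complex.Im z - complex.Im w); lra.
Qed.

End ComplexNumbers.

(** * The space L2(D) and its inner product *)

Section SquareIntegrable.
Variables (R : realType) (D : set R).
Hypothesis mD : measurable D.
Local Open Scope classical_set_scope.
Notation mu := (@lebesgue_measure R).
Implicit Types (f g h : R -> R[i]) (c : R[i]).

Definition cmeas f :=
  measurable_fun D (fun x => complex.Re (f x) : R) /\
  measurable_fun D (fun x => complex.Im (f x) : R).

Definition cintegrable f :=
  mu.-integrable D (EFin \o (fun x => complex.Re (f x) : R)) /\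
  mu.-integrable D (EFin \o (fun x => complex.Im (f x) : R)).

(** Kept in the extended reals: finiteness is a separate fact, and the integration theorems for
    nonnegative functions apply directly. *)
Definition L2norm2 f : \bar R := (\int[mu]_(x in D) (normc (f x) ^+ 2)%:E)%E.

Lemma L2E f : L2 D f <-> cmeas f /\ (L2norm2 f < +oo)%E.
Proof. by split => [[]|[[]]]. Qed.

Lemma cmeasD f g : cmeas f -> cmeas g -> cmeas (fun x => f x + g x).
Proof.
move=> [f1 f2] [g1 g2]; split.
  by under eq_fun do rewrite ReD; apply: measurable_funD.
by under eq_fun do rewrite ImD; apply: measurable_funD.
Qed.

Lemma cmeasM f g : cmeas f -> cmeas g -> cmeas (fun x => f x * g x).
Proof.
move=> [f1 f2] [g1 g2]; split.
  by under eq_fun do rewrite ReM; apply: measurable_funB; apply: measurable_funM.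
by under eq_fun do rewrite ImM; apply: measurable_funD; apply: measurable_funM.
Qed.

Lemma cmeas_cst c : cmeas (fun=> c).
Proof. by split; exact: measurable_cst. Qed.

Lemma cmeasZ c f : cmeas f -> cmeas (fun x => c * f x).
Proof. by apply: cmeasM; exact: cmeas_cst. Qed.

Lemma cmeas_sum I (s : seq I) (F : I -> R -> R[i]) :
  (forall i, cmeas (F i)) -> cmeas (fun x => \sum_(i <- s) F i x).
Proof.
move=> mF; elim: s => [|i s ih].
  by under eq_fun do rewrite big_nil; exact: cmeas_cst.
by under eq_fun do rewrite big_cons; exact: cmeasD.
Qed.

Lemma cmeas_conj f : cmeas f -> cmeas (fun x => conjc (f x)).
Proof.
move=> [f1 f2]; split.
  by under eq_fun do rewrite Re_conjc.
by under eq_fun do rewrite Im_conjc; exact: measurable_funN.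
Qed.

Lemma measurable_normc_sqr f : cmeas f ->
  measurable_fun D (fun x => normc (f x) ^+ 2).
Proof.
move=> [f1 f2]; under eq_fun do rewrite normc_sqr.
by apply: measurable_funD; exact: measurable_funX.
Qed.

Lemma measurable_normc_sqrE f : cmeas f ->
  measurable_fun D (fun x => (normc (f x) ^+ 2)%:E).
Proof. by move=> mf; apply/measurable_EFinP; exact: measurable_normc_sqr. Qed.

Lemma L2norm2_ge0 f : (0 <= L2norm2 f)%E.
Proof. by apply: integral_ge0 => x _; rewrite lee_fin sqr_ge0. Qed.

Lemma L2norm2D_le f g : cmeas f -> cmeas g ->
  (L2norm2 (fun x => (f x + g x)%R) <= 2%:E * L2norm2 f + 2%:E * L2norm2 g)%E.
Proof.
move=> mf mg; rewrite /L2norm2 -!ge0_integralZl//; last 4 first.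
- exact: measurable_normc_sqrE.
- by move=> x _; rewrite lee_fin sqr_ge0.
- exact: measurable_normc_sqrE.
- by move=> x _; rewrite lee_fin sqr_ge0.
rewrite -ge0_integralD//; last 4 first.
- by move=> x _; rewrite -EFinM lee_fin mulr_ge0 ?sqr_ge0.
- by apply: measurable_funeM; exact: measurable_normc_sqrE.
- by move=> x _; rewrite -EFinM lee_fin mulr_ge0 ?sqr_ge0.
- by apply: measurable_funeM; exact: measurable_normc_sqrE.
apply: ge0_le_integral => //.
- by move=> x _; rewrite lee_fin sqr_ge0.
- by apply: measurable_normc_sqrE; exact: cmeasD.
- by apply: emeasurable_funD; apply: measurable_funeM; exact: measurable_normc_sqrE.
- by move=> x _; rewrite -!EFinM -EFinD lee_fin normc_sqrD_le.
Qed.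

Lemma L2norm2Z c f : cmeas f ->
  L2norm2 (fun x => c * f x) = ((normc c ^+ 2)%:E * L2norm2 f)%E.
Proof.
move=> mf; rewrite /L2norm2 -ge0_integralZl//.
- by apply: eq_integral => x _; rewrite normcM exprMn EFinM.
- exact: measurable_normc_sqrE.
- by move=> x _; rewrite lee_fin sqr_ge0.
- by rewrite lee_fin sqr_ge0.
Qed.

Lemma L2D (f g : R -> R[i]^o) : L2 D f -> L2 D g -> L2 D (f + g).
Proof.
move=> /L2E[mf f2] /L2E[mg g2]; apply/L2E; split; first exact: cmeasD.
apply: le_lt_trans (L2norm2D_le mf mg) _.
by apply: lte_add_pinfty; apply: lte_mul_pinfty => //; rewrite ?lee_fin.
Qed.

Lemma L2Z c (f : R -> R[i]^o) : L2 D f -> L2 D (c *: f).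
Proof.
move=> /L2E[mf f2]; apply/L2E; split; first exact: cmeasZ.
have := L2norm2Z c mf; rewrite /GRing.scale/= => ->.
by apply: lte_mul_pinfty => //; rewrite lee_fin sqr_ge0.
Qed.

Lemma L2_0 : L2 D 0.
Proof.
apply/L2E; split; first exact: cmeas_cst.
by rewrite /L2norm2 integral0_eq// => x _; rewrite /= expr0n/= addr0 sqrtr0 expr0n.
Qed.

Lemma le_cintegrable f (b : R -> R) : cmeas f ->
  (forall x, D x -> normc (f x) <= b x) ->
  mu.-integrable D (EFin \o b) -> cintegrable f.
Proof.
move=> [mr mi] fb ib; split.
- apply: le_integrable ib => //; first exact/measurable_EFinP.
  move=> x Dx /=; rewrite lee_fin (le_trans (le_Re_normc _))//.
  by rewrite (le_trans (fb x Dx))// ler_norm.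
- apply: le_integrable ib => //; first exact/measurable_EFinP.
  move=> x Dx /=; rewrite lee_fin (le_trans (le_Im_normc _))//.
  by rewrite (le_trans (fb x Dx))// ler_norm.
Qed.

Lemma integrable_normc_sqr f : L2 D f ->
  mu.-integrable D (EFin \o (fun x => normc (f x) ^+ 2)).
Proof.
move=> /L2E[mf f2]; apply/integrableP; split.
  exact: measurable_normc_sqrE.
by under eq_integral do rewrite /= ger0_norm ?sqr_ge0//.
Qed.

(** The modulus |f| |g| is dominated by |f|^2 + |g|^2, which is integrable. *)
Lemma cintegrable_mul_conj f g : L2 D f -> L2 D g ->
  cintegrable (fun x => f x * conjc (g x)).
Proof.
move=> Lf Lg; have /L2E[mf _] := Lf; have /L2E[mg _] := Lg.
apply: (@le_cintegrable _ (fun x => normc (f x) ^+ 2 + normc (g x) ^+ 2)).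
- by apply: cmeasM => //; exact: cmeas_conj.
- move=> x _; rewrite normcM normc_conj.
  by have := normc_ge0 (f x); have := normc_ge0 (g x); nra.
- rewrite [EFin \o _](_ : _ =
      ((EFin \o (fun x => normc (f x) ^+ 2)%R) \+
       (EFin \o (fun x => normc (g x) ^+ 2)%R))%E); last by apply/funext.
  by apply: integrableD => //; exact: integrable_normc_sqr.
Qed.

Lemma cintegralD f g : cintegrable f -> cintegrable g ->
  cintegral D (fun x => f x + g x) = cintegral D f + cintegral D g.
Proof.
move=> [f1 f2] [g1 g2]; apply: complex_ext; rewrite ?ReD ?ImD /=.
- by rewrite -RintegralD//; apply: eq_Rintegral => x _; rewrite ReD.
- by rewrite -RintegralD//; apply: eq_Rintegral => x _; rewrite ImD.
Qed.

Lemma integrableZ_EFin (r : R) (f : R -> R) : mu.-integrable D (EFin \o f) ->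
  mu.-integrable D (EFin \o (fun x => r * f x)).
Proof.
move=> i; rewrite [EFin \o _](_ : _ = fun x => (r%:E * (EFin \o f) x)%E)//.
exact: integrableZl.
Qed.

Lemma cintegralZ c f : cintegrable f ->
  cintegral D (fun x => c * f x) = c * cintegral D f.
Proof.
move=> [f1 f2]; apply: complex_ext; rewrite ?ReM ?ImM /=.
- rewrite -!RintegralZl// -RintegralB//; try exact: integrableZ_EFin.
  by apply: eq_Rintegral => x _; rewrite ReM.
- rewrite -!RintegralZl// -RintegralD//; try exact: integrableZ_EFin.
  by apply: eq_Rintegral => x _; rewrite ImM.
Qed.

Lemma cintegral_conj f : cintegrable f ->
  cintegral D (fun x => conjc (f x)) = conjc (cintegral D f).
Proof.
move=> [f1 f2]; apply: complex_ext; rewrite ?Re_conjc ?Im_conjc /=.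
- by apply: eq_Rintegral => x _; rewrite Re_conjc.
- rewrite -mulN1r -RintegralZl//.
  by apply: eq_Rintegral => x _; rewrite Im_conjc mulN1r.
Qed.

Lemma L2_ipDl (f g h : R -> R[i]^o) : L2 D f -> L2 D g -> L2 D h ->
  L2_ip D (f + g) h = L2_ip D f h + L2_ip D g h.
Proof.
move=> Lf Lg Lh; rewrite /L2_ip -cintegralD; try exact: cintegrable_mul_conj.
by congr cintegral; apply/funext => x; rewrite mulrDl.
Qed.

Lemma L2_ipZl c (f h : R -> R[i]^o) : L2 D f -> L2 D h ->
  L2_ip D (c *: f) h = c * L2_ip D f h.
Proof.
move=> Lf Lh; rewrite /L2_ip -cintegralZ; last exact: cintegrable_mul_conj.
by congr cintegral; apply/funext => x; rewrite mulrA.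
Qed.

Lemma L2_ipC f g : L2 D f -> L2 D g -> L2_ip D g f = conjc (L2_ip D f g).
Proof.
move=> Lf Lg; rewrite /L2_ip -cintegral_conj; last exact: cintegrable_mul_conj.
by congr cintegral; apply/funext => x; rewrite rmorphM/= conjcK mulrC.
Qed.

Lemma ip_normsq_L2 f : ip_normsq (L2_ip D) f = fine (L2norm2 f).
Proof.
rewrite /ip_normsq /L2_ip /cintegral /= /Rintegral /L2norm2; congr fine.
by apply: eq_integral => x _; rewrite mulc_conj.
Qed.

Lemma EFin_ip_normsq_L2 f : L2 D f -> (ip_normsq (L2_ip D) f)%:E = L2norm2 f.
Proof.
move=> /L2E[_ f2]; rewrite ip_normsq_L2 fineK// ge0_fin_numE//.
exact: L2norm2_ge0.
Qed.

Lemma ip_normsq_L2_ge0 f : 0 <= ip_normsq (L2_ip D) f.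
Proof. by rewrite ip_normsq_L2 fine_ge0// L2norm2_ge0. Qed.

Lemma L2norm2_0 : L2norm2 (fun=> 0) = 0%E.
Proof.
by rewrite /L2norm2 integral0_eq// => x _; rewrite /= expr0n/= addr0 sqrtr0 expr0n.
Qed.

Lemma cmeasB f g : cmeas f -> cmeas g ->
  cmeas (fun x => f x - g x).
Proof.
move=> mf mg; apply: cmeasD => //.
under eq_fun do rewrite -mulN1r; exact: cmeasZ.
Qed.

Lemma eq_cmeas f g : {in D, f =1 g} -> cmeas f -> cmeas g.
Proof.
by move=> fg [m1 m2]; split; [apply: eq_measurable_fun m1|apply: eq_measurable_fun m2];
  move=> x xD; rewrite fg.
Qed.

Lemma eq_L2norm2 f g : {in D, f =1 g} -> L2norm2 f = L2norm2 g.
Proof. by move=> fg; apply: eq_integral => x xD; rewrite fg. Qed.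

End SquareIntegrable.

(** * Parseval's identity in a pre-Hilbert space *)

Section PreHilbert.
Variables (R : realType) (V : lmodType R[i]) (H : set V) (ip : V -> V -> R[i]).
(** The laws of an inner product are asked only on [H], because an integral is not linear on
    arbitrary functions. Definiteness is not among them: an L2 function vanishing almost everywhere
    need not be 0. *)
Hypothesis H0 : H 0.
Hypothesis HD : forall f g, H f -> H g -> H (f + g).
Hypothesis HZ : forall c f, H f -> H (c *: f).
Hypothesis ipDl : forall f g h, H f -> H g -> H h ->
  ip (f + g) h = ip f h + ip g h.
Hypothesis ipZl : forall c f h, H f -> H h -> ip (c *: f) h = c * ip f h.
Hypothesis ipC : forall f g, H f -> H g -> ip g f = conjc (ip f g).
Hypothesis ip_ge0 : forall f, H f -> 0 <= ip_normsq ip f.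
Notation nsq := (ip_normsq ip).

Lemma ipDr f g h : H f -> H g -> H h -> ip h (f + g) = ip h f + ip h g.
Proof.
move=> Hf Hg Hh; rewrite (ipC (HD Hf Hg) Hh) ipDl// rmorphD/=.
by rewrite -(ipC Hf Hh) -(ipC Hg Hh).
Qed.

Lemma ip_normsqD f g : H f -> H g ->
  nsq (f + g) = nsq f + nsq g + 2 * complex.Re (ip f g).
Proof.
move=> Hf Hg; rewrite /ip_normsq ipDl ?ipDr//; try exact: HD.
rewrite !ReD (ipC Hf Hg) Re_conjc; ring.
Qed.

Lemma H_sum I (s : seq I) (v : I -> V) : (forall i, H (v i)) ->
  H (\sum_(i <- s) v i).
Proof. by move=> Hv; elim/big_ind : _. Qed.

Lemma ip_suml I (s : seq I) (v : I -> V) (c : I -> R[i]) g :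
  (forall i, H (v i)) -> H g ->
  ip (\sum_(i <- s) c i *: v i) g = \sum_(i <- s) c i * ip (v i) g.
Proof.
move=> Hv Hg; elim: s => [|i s ih].
  by rewrite !big_nil -(scale0r 0) ipZl// mul0r.
rewrite !big_cons ipDl ?ipZl ?ih//; first exact: HZ.
by apply: H_sum => j; exact: HZ.
Qed.

Lemma HB f g : H f -> H g -> H (f - g).
Proof. by move=> Hf Hg; apply: HD => //; rewrite -scaleN1r; exact: HZ. Qed.

Section Orthonormal.
Variables (I : choiceType) (e : I -> V).
Hypothesis He : forall i, H (e i).
Hypothesis orthonormal_e : forall i j, ip (e i) (e j) = (i == j)%:R.

Lemma ip_orthonormal_sum (s : seq I) (c : I -> R[i]) k : uniq s ->
  ip (\sum_(i <- s) c i *: e i) (e k) = if k \in s then c k else 0.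
Proof.
move=> us; rewrite ip_suml//; case: ifPn => ks.
  rewrite (bigD1_seq k)//= orthonormal_e eqxx mulr1 big1 ?addr0// => i /negPf ik.
  by rewrite orthonormal_e ik mulr0.
rewrite big_seq big1// => i is_; rewrite orthonormal_e.
by case: eqP => [ik|_]; rewrite ?mulr0//; rewrite -ik is_ in ks.
Qed.

Lemma ip_normsq_orthonormal_sum (s : seq I) (c : I -> R[i]) : uniq s ->
  nsq (\sum_(i <- s) c i *: e i) = \sum_(i <- s) normc (c i) ^+ 2.
Proof.
move=> us; rewrite /ip_normsq ip_suml//; last by apply: H_sum => i; exact: HZ.
rewrite Re_sum [LHS]big_seq [RHS]big_seq; apply: eq_bigr => i is_.
rewrite ipC//; last by apply: H_sum => j; exact: HZ.
by rewrite ip_orthonormal_sum// is_ mulc_conj.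
Qed.

(** The orthogonal projection of [f] onto the span of the [e i] with [i] in [s]. *)
Definition fourier_sum (s : seq I) f := \sum_(i <- s) ip f (e i) *: e i.

Lemma H_fourier_sum s f : H (fourier_sum s f).
Proof. by apply: H_sum => i; exact: HZ. Qed.

Lemma residual_orthogonal s f k : uniq s -> H f -> k \in s ->
  ip (f - fourier_sum s f) (e k) = 0.
Proof.
move=> us Hf ks; have HP := H_fourier_sum s f.
rewrite -scaleN1r ipDl//; last exact: HZ.
by rewrite ipZl// ip_orthonormal_sum// ks mulN1r subrr.
Qed.

(** The span as a double orthogonal complement. This form passes to sums and multiples at once and
    is exactly what Pythagoras' theorem consumes. *)
Definition in_span (s : seq I) p := H p /\ forall w, H w ->
  (forall k, k \in s -> ip w (e k) = 0) -> ip w p = 0.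

Lemma in_span_fourier_sum s f : in_span s (fourier_sum s f).
Proof.
split; first exact: H_fourier_sum.
move=> w Hw w0; rewrite ipC//; last exact: H_fourier_sum.
rewrite ip_suml// big_seq big1 ?conjc0// => i is_.
by rewrite (ipC Hw (He i)) w0// conjc0 mulr0.
Qed.

(** The residual is orthogonal to the Fourier sum and to [p], so the cross term vanishes. In
    particular the Fourier sum is the best approximation of [f] in the span. *)
Lemma pythagoras s f p : uniq s -> H f -> in_span s p ->
  nsq (f - p) = nsq (f - fourier_sum s f) + nsq (fourier_sum s f - p).
Proof.
move=> us Hf [Hp p0]; have HP := H_fourier_sum s f.
have -> : f - p = (f - fourier_sum s f) + (fourier_sum s f - p).
  by rewrite addrA subrK.
have Hr : H (f - fourier_sum s f) by exact: HB.
rewrite ip_normsqD//; last exact: HB.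
rewrite ipDr//; last by rewrite -scaleN1r; exact: HZ.
have r0 k : k \in s -> ip (f - fourier_sum s f) (e k) = 0.
  exact: residual_orthogonal.
have -> : ip (f - fourier_sum s f) (- p) = 0.
  have Hr' : H (-1 *: p) by exact: HZ.
  by rewrite -[- p]scaleN1r (ipC Hr' Hr) ipZl// (ipC Hr Hp) p0// conjc0 mulr0 conjc0.
rewrite (in_span_fourier_sum s f).2// addr0.
by rewrite mulr0 addr0.
Qed.

(** Pythagoras with [p = 0]. As the left side is nonnegative, this contains Bessel's inequality. *)
Lemma ip_normsq_residual s f : uniq s -> H f ->
  nsq (f - fourier_sum s f) = nsq f - \sum_(i <- s) normc (ip f (e i)) ^+ 2.
Proof.
move=> us Hf; have sp0 : in_span s 0.
  split=> // w Hw _; rewrite ipC// -(scale0r 0) ipZl// mul0r conjc0//.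
have := pythagoras us Hf sp0; rewrite !subr0 => ->.
by rewrite ip_normsq_orthonormal_sum// addrK.
Qed.

Lemma parseval f : H f ->
  (forall eps, 0 < eps -> exists (s : {fset I}) p,
     in_span s p /\ nsq (f - p) < eps) ->
  \esum_(i in [set: I]) (normc (ip f (e i)) ^+ 2)%:E = (nsq f)%:E.
Proof.
move=> Hf dense; apply/eqP; rewrite eq_le; apply/andP; split.
  apply: ge_ereal_sup => _ [A [finA _] <-].
  rewrite fsbig_finite//= sumEFin lee_fin -subr_ge0 -ip_normsq_residual//.
  by apply: ip_ge0; apply: HB => //; exact: H_fourier_sum.
(* The Fourier sum over [s] approximates [f] at least as well as [p] does, so the partial sum over
   [s] misses the squared norm of [f] by at most [eps]. *)
apply/lee_addgt0Pr => eps eps0; have [s [p [sp lt_eps]]] := dense _ eps0.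
apply: (@le_trans _ _ ((\sum_(i <- s) normc (ip f (e i)) ^+ 2 + eps)%:E)).
  rewrite lee_fin -lerBlDl -ip_normsq_residual//.
  apply: le_trans (ltW lt_eps); rewrite (pythagoras _ Hf sp)// lerDl.
  by apply: ip_ge0; apply: HB; [exact: H_fourier_sum|exact: sp.1].
rewrite EFinD leeD2r//; apply: esum_ge; exists [set` s]%classic; first by split.
by rewrite fsbig_finite//= set_fsetK sumEFin.
Qed.

End Orthonormal.
End PreHilbert.

(** * Density of the trigonometric polynomials *)

Section Exponentials.
Variable R : realType.
Implicit Types (a b x y : R) (n m : int).

Lemma expoD a b x : expo (a + b) x = expo a x * expo b x.
Proof.
rewrite /expo; have -> : 2 * pi * (a + b) * x = 2 * pi * a * x + 2 * pi * b * x by ring.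
by apply: complex_ext; rewrite ?ReM ?ImM/= ?cosD ?sinD//; ring.
Qed.

Lemma expoDr a x y : expo a (x + y) = expo a x * expo a y.
Proof.
rewrite /expo; have -> : 2 * pi * a * (x + y) = 2 * pi * a * x + 2 * pi * a * y by ring.
by apply: complex_ext; rewrite ?ReM ?ImM/= ?cosD ?sinD//; ring.
Qed.

Lemma expoN a x : expo (- a) x = conjc (expo a x).
Proof. by rewrite /expo/= mulrN mulNr cosN sinN. Qed.

Lemma expo0 x : expo 0 x = 1.
Proof. by rewrite /expo mulr0 mul0r cos0 sin0. Qed.

Lemma normc_expo a x : normc (expo a x) = 1.
Proof. by rewrite /expo /= cos2Dsin2 sqrtr1. Qed.

Lemma cos_sin_int n : cos (2 * pi * n%:~R) = 1 :> R /\ sin (2 * pi * n%:~R) = 0 :> R.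
Proof.
have nat_case k : cos (2 * pi * k%:R) = 1 :> R /\ sin (2 * pi * k%:R) = 0 :> R.
  have -> : 2 * pi * k%:R = 0 + (pi *+ 2) *+ k :> R by rewrite add0r -(mulr_natr _ k) -(mulr_natr pi 2); ring.
  split; first by rewrite (periodicn (@cosD2pi R)) cos0.
  by rewrite (periodicn (@sinD2pi R)) sin0.
case: n => k; first exact: nat_case.
by rewrite NegzE mulrNz mulrN cosN sinN; case: (nat_case k.+1) => -> ->; rewrite oppr0.
Qed.

Lemma expo_int n m : expo n%:~R (m%:~R : R) = 1.
Proof.
rewrite /expo -mulrA -intrM; have [-> ->] := cos_sin_int (n * m).
by [].
Qed.

Lemma cmeas_expo (D : set R) a : cmeas D (expo a).
Proof.
split; apply: measurable_funTS; apply: continuous_measurable_fun => x /=.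
- apply: (@continuous_comp _ _ _ (fun x => 2 * pi * a * x) (@cos R)).
    exact: mulrl_continuous.
  exact: continuous_cos.
- apply: (@continuous_comp _ _ _ (fun x => 2 * pi * a * x) (@sin R)).
    exact: mulrl_continuous.
  exact: continuous_sin.
Qed.

(** The trigonometric polynomials of period 1, as a predicate rather than by coefficients: closure
    under products and membership in a finite span then follow by induction. *)
Inductive trig : (R -> R[i]^o) -> Prop :=
| trig_expo n : trig (expo n%:~R)
| trigD p q : trig p -> trig q -> trig (p + q)
| trigZ c p : trig p -> trig (c *: p).

Lemma trig_expo_mul n p : trig p -> trig (fun x => expo n%:~R x * p x).
Proof.
elim=> [m|{}p q _ hp _ hq|c {}p _ hp].
- have -> : (fun x : R => expo n%:~R x * expo m%:~R x) = expo (n + m)%:~R.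
    by apply/funext => x; rewrite intrD expoD.
  exact: trig_expo.
- have -> : (fun x : R => expo n%:~R x * (p + q) x) =
      (fun x => expo n%:~R x * p x) + (fun x => expo n%:~R x * q x).
    by apply/funext => x; rewrite /= mulrDr.
  exact: trigD.
- have -> : (fun x : R => expo n%:~R x * (c *: p) x) =
      c *: (fun x => expo n%:~R x * p x).
    by apply/funext => x; exact: mulrCA.
  exact: trigZ.
Qed.

Lemma trigM p q : trig p -> trig q -> trig (fun x => p x * q x).
Proof.
move=> + tq; elim=> [n|{}p r _ hp _ hr|c {}p _ hp].
- exact: trig_expo_mul.
- have -> : (fun x => (p + r) x * q x) = (fun x => p x * q x) + (fun x => r x * q x).
    by apply/funext => x; rewrite /= mulrDl.
  exact: trigD.
- have -> : (fun x => (c *: p) x * q x) = c *: (fun x => p x * q x).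
    by apply/funext => x; exact/esym/mulrA.
  exact: trigZ.
Qed.

Lemma trig_cst (c : R[i]) : trig (fun=> c).
Proof.
have -> : (fun=> c) = c *: expo 0%:~R :> (R -> R[i]^o).
  by apply/funext => x; rewrite fctE expo0 [RHS]mulr1.
by apply: trigZ; exact: trig_expo.
Qed.

Lemma trigX p k : trig p -> trig (fun x => (p x) ^+ k).
Proof.
move=> tp; elim: k => [|k ih]; first exact: trig_cst.
have -> : (fun x => p x ^+ k.+1) = (fun x => p x * p x ^+ k).
  by apply/funext => x; rewrite exprS.
exact: trigM.
Qed.

Lemma trig_cos c : trig (fun x => (cos (2 * pi * (x - c)))%:C%C).
Proof.
(* Euler's formula; the two coefficients are exp(-2 pi i c) / 2 and exp(2 pi i c) / 2. *)
have -> : (fun x => (cos (2 * pi * (x - c)))%:C%C) =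
    (Complex (cos (2 * pi * c) / 2) (- sin (2 * pi * c) / 2) : R[i]) *: expo 1%:~R
    + (Complex (cos (2 * pi * c) / 2) (sin (2 * pi * c) / 2) : R[i]) *: expo (-1)%:~R
    :> (R -> R[i]^o).
  apply/funext => x; rewrite !fctE mulrBr cosB.
  rewrite mulrNz expoN /expo mulr1.
  by apply: complex_ext; rewrite ?ReD ?ImD ?ReM ?ImM /=; field.
by apply: trigD; apply: trigZ; exact: trig_expo.
Qed.

Lemma cmeas_trig (D : set R) p : trig p -> cmeas D p.
Proof.
elim=> [n|{}p q _ mp _ mq|c {}p _ mp]; first exact: cmeas_expo.
- exact: cmeasD.
- exact: cmeasZ.
Qed.

End Exponentials.

(** * Polynomials converging to a step function *)

Section StepApproximation.
Variable R : realType.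
Local Open Scope classical_set_scope.
Implicit Types (s y t : R).

Lemma bernoulli t k : 0 <= t <= 1 -> 1 - k%:R * t <= (1 - t) ^+ k.
Proof.
move=> /andP[t0 t1]; elim: k => [|k ih]; first by rewrite mul0r subr0 expr0.
rewrite exprS; apply: (@le_trans _ _ ((1 - t) * (1 - k%:R * t))).
  by rewrite -natr1; have := ler0n R k; nra.
by rewrite ler_wpM2l// subr_ge0.
Qed.

(** The left side for k + 1 is (1 - t) times the left side for k plus t times (1 - t)^(k + 1), an
    average of two quantities that are at most 1. *)
Lemma bernoulli_inv t k : 0 <= t <= 1 -> (1 - t) ^+ k * (k%:R * t) <= 1.
Proof.
move=> /andP[t0 t1]; elim: k => [|k ih]; first by rewrite mul0r mulr0.
have p0 : 0 <= (1 - t) ^+ k by rewrite exprn_ge0// subr_ge0.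
have p1 : (1 - t) ^+ k <= 1 by rewrite exprn_ile1// ?subr_ge0// gerBl.
rewrite exprS -natr1; nra.
Qed.

(** For [s > 0], an integer K with s^-n < K <= s^-n + 1. The upper bound serves the case y < s, the
    lower bound the case y > s. *)
Definition step_exponent s n := (Num.truncn (s^-1 ^+ n)).+1.

(* The limit is the indicator function of [y < s]: the exponent grows like
   s^-n, so its product with y^n tends to 0 for y < s and to oo for y > s. *)
Definition step_approx s n y := (1 - y ^+ n) ^+ step_exponent s n.

Lemma step_approx_ge0 s n y : 0 <= y <= 1 -> 0 <= step_approx s n y.
Proof.
by move=> /andP[y0 y1]; rewrite exprn_ge0// subr_ge0 exprn_ile1.
Qed.

Lemma step_approx_le1 s n y : 0 <= y <= 1 -> step_approx s n y <= 1.
Proof.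
move=> /andP[y0 y1]; rewrite exprn_ile1//; last by rewrite gerBl exprn_ge0.
by rewrite subr_ge0 exprn_ile1.
Qed.

Lemma cvg_step_approx s y : 0 < s -> 0 <= y <= 1 -> s <= 1 -> y != s ->
  step_approx s n y @[n --> \oo] --> ((y < s)%R%:R : R).
Proof.
move=> s0 y01 s1 ys; have /andP[y0 y1] := y01.
have yn01 n : 0 <= y ^+ n <= 1 by rewrite exprn_ge0//= exprn_ile1.
have [lt_ys|le_sy] := ltP y s.
  have zlt1 : `|y / s| < 1.
    by rewrite ger0_norm ?divr_ge0// ?(ltW s0)// ltr_pdivrMr// mul1r.
  have ylt1 : `|y| < 1 by rewrite ger0_norm// (lt_le_trans lt_ys).
  (* Bernoulli's inequality with an exponent at most s^-n + 1 gives this lower bound. *)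
  apply: (@squeeze_cvgr _ _ _ _ (fun n => 1 - (y / s) ^+ n - y ^+ n) (cst 1)).
  - apply: nearW => n; rewrite step_approx_le1// andbT.
    apply: le_trans (bernoulli _ (yn01 n)).
    have : (step_exponent s n)%:R <= s^-1 ^+ n + 1.
      rewrite /step_exponent -natr1 lerD2r truncn_le exprn_ge0// invr_ge0.
      exact: ltW.
    have /andP[yn0 _] := yn01 n.
    move=> /(ler_wpM2r yn0); rewrite mulrDl mul1r -exprMn [s^-1 * y]mulrC; lra.
  - suff : (1 - (y / s) ^+ n - y ^+ n) @[n --> \oo] --> (1 - 0 - 0 : R).
      by rewrite !subr0.
    apply: (@cvgB _ R^o); last exact: cvg_expr.
    by apply: (@cvgB _ R^o); [exact: cvg_cst|exact: cvg_expr].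
  - exact: cvg_cst.
have {le_sy ys}lt_sy : s < y by rewrite lt_neqAle eq_sym ys.
have y_gt0 : 0 < y by exact: lt_trans lt_sy.
have zlt1 : `|s / y| < 1.
  by rewrite ger0_norm ?divr_ge0// ?(ltW s0)// ltr_pdivrMr// mul1r.
(* By [bernoulli_inv] the value is at most 1 / (K y^n), where the exponent K is at least s^-n. *)
apply: (@squeeze_cvgr _ _ _ _ (cst 0) (fun n => (s / y) ^+ n)).
- apply: nearW => n; rewrite step_approx_ge0//=.
  have := bernoulli_inv (step_exponent s n) (yn01 n).
  have : s^-1 ^+ n <= (step_exponent s n)%:R by exact/ltW/truncnS_gt.
  have yn_gt0 : 0 < y ^+ n by exact: exprn_gt0.
  move=> /(ler_wpM2r (ltW yn_gt0)) h1 h2.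
  rewrite -[(s / y) ^+ n]invrK -exprVn invf_div -div1r ler_pdivlMr; last first.
    by rewrite exprn_gt0// divr_gt0.
  apply: le_trans h2; rewrite ler_wpM2l ?step_approx_ge0//.
  by rewrite exprMn mulrC.
- exact: cvg_cst.
- exact: cvg_expr.
Qed.

End StepApproximation.

(** * Approximation by trigonometric polynomials in L2 of [0, 1) *)

Section Density.
Variable R : realType.
Local Open Scope classical_set_scope.
Notation mu := (@lebesgue_measure R).
Notation U := (`[0%R, 1%R[%classic : set R).
Implicit Types (f g : R -> R[i]) (h : R -> R).

Let mU : measurable U. Proof. exact: measurable_itv. Qed.

(** The L2 closure of the trigonometric polynomials. Measurability is included so that the closure
    properties carry it along. *)
Definition trig_approx f := cmeas U f /\ forall eps, 0 < eps ->
  exists p, trig p /\ (L2norm2 U (fun x => (f x - p x)%R) < eps%:E)%E.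

Lemma eq_trig_approx f g : {in U, f =1 g} -> trig_approx f -> trig_approx g.
Proof.
move=> fg [mf af]; split; first exact: eq_cmeas mf.
move=> eps /af[p [tp fp]]; exists p; split => //.
by rewrite (@eq_L2norm2 _ _ _ (fun x => f x - p x))// => x xU; rewrite fg.
Qed.

Lemma trig_approx_trig p : trig p -> trig_approx p.
Proof.
move=> tp; split; first exact: cmeas_trig.
move=> eps eps0; exists p; split => //.
by rewrite (@eq_L2norm2 _ _ _ (fun=> 0)) ?L2norm2_0 ?lte_fin// => x _; rewrite subrr.
Qed.

Lemma trig_approxD f g : trig_approx f -> trig_approx g ->
  trig_approx (fun x => f x + g x).
Proof.
move=> [mf af] [mg ag]; split; first exact: cmeasD.
(* A quarter suffices since [L2norm2D_le] doubles each of the two errors. *)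
move=> eps eps0; have eps4 : 0 < eps / 4 by rewrite divr_gt0.
have [p [tp fp]] := af _ eps4; have [q [tq gq]] := ag _ eps4.
exists (p + q); split; first exact: trigD.
rewrite (_ : (fun x => _) = fun x => (f x - p x) + (g x - q x)); last first.
  by apply/funext => x; rewrite opprD addrACA.
apply: (le_lt_trans (L2norm2D_le _ _ _)) => //.
- by apply: cmeasB => //; exact: cmeas_trig.
- by apply: cmeasB => //; exact: cmeas_trig.
have -> : eps%:E = (2%:E * (eps / 4)%:E + 2%:E * (eps / 4)%:E)%E.
  by rewrite -!EFinM -EFinD; congr EFin; field.
by apply: lteD; rewrite lte_pmul2l.
Qed.

Lemma trig_approxZ c f : trig_approx f -> trig_approx (fun x => c * f x).
Proof.
move=> [mf af]; split; first exact: cmeasZ.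
(* The added 1 keeps the divisor positive when [c = 0]. *)
move=> eps eps0; have c0 : 0 < normc c ^+ 2 + 1 by rewrite ltr_wpDl// sqr_ge0.
have [p [tp fp]] := af _ (divr_gt0 eps0 c0).
exists (c *: p); split; first exact: trigZ.
rewrite (_ : (fun x => _) = fun x => c * (f x - p x)); last first.
  by apply/funext => x; rewrite mulrBr.
rewrite L2norm2Z//; last by apply: cmeasB => //; exact: cmeas_trig.
have -> : eps%:E = ((normc c ^+ 2 + 1)%:E * (eps / (normc c ^+ 2 + 1))%:E)%E.
  by rewrite -EFinM mulrC divfK// gt_eqF.
apply: (@le_lt_trans _ _ ((normc c ^+ 2 + 1)%:E * L2norm2 U (fun x => (f x - p x)%R))%E).
  by apply: lee_wpmul2r; [exact: L2norm2_ge0|rewrite lee_fin lerDl].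
by rewrite lte_pmul2l// lte_fin.
Qed.

Lemma trig_approx_sum I (s : seq I) (F : I -> R -> R[i]) :
  (forall i, trig_approx (F i)) -> trig_approx (fun x => \sum_(i <- s) F i x).
Proof.
move=> aF; elim: s => [|i s ih].
  by under eq_fun do rewrite big_nil; apply: trig_approx_trig; exact: trig_cst.
by under eq_fun do rewrite big_cons; exact: trig_approxD.
Qed.

Lemma trig_approx_lim f : cmeas U f ->
  (forall eps, 0 < eps -> exists g, trig_approx g /\
     (L2norm2 U (fun x => (f x - g x)%R) < eps%:E)%E) ->
  trig_approx f.
Proof.
move=> mf lf; split => // eps eps0; have eps4 : 0 < eps / 4 by rewrite divr_gt0.
have [g [[mg ag] fg]] := lf _ eps4; have [p [tp gp]] := ag _ eps4.
exists p; split => //.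
rewrite (_ : (fun x => _) = fun x => (f x - g x) + (g x - p x)); last first.
  by apply/funext => x; rewrite addrA subrK.
apply: (le_lt_trans (L2norm2D_le _ _ _)) => //.
- exact: cmeasB.
- by apply: cmeasB => //; exact: cmeas_trig.
have -> : eps%:E = (2%:E * (eps / 4)%:E + 2%:E * (eps / 4)%:E)%E.
  by rewrite -!EFinM -EFinD; congr EFin; field.
by apply: lteD; rewrite lte_pmul2l.
Qed.

Definition trig_approxR h := trig_approx (fun x => (h x)%:C%C).

Lemma cmeas_real (D : set R) h :
  measurable_fun D h -> cmeas D (fun x => (h x)%:C%C).
Proof. by move=> mh; split => //; exact: measurable_cst. Qed.

Lemma normc_sqr_realB (a b : R) : normc (a%:C%C - b%:C%C) ^+ 2 = (a - b) ^+ 2.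
Proof. by rewrite normc_sqr ReD ImD /= subrr [0 ^+ 2]expr0n addr0. Qed.

Lemma trig_approxR_measurable h : trig_approxR h -> measurable_fun U h.
Proof. by case=> [[]]. Qed.

(** Dominated convergence applied to the squared errors, followed by closedness of the closure. The
    null set [N] makes room for the ends of an arc, where the step approximations have another
    limit. *)
Lemma trig_approx_dominated (N : set R) (hs : nat -> R -> R) h (g : R -> R) :
  mu.-negligible N ->
  (forall n, trig_approxR (hs n)) -> measurable_fun U h ->
  mu.-integrable U (EFin \o g) ->
  (forall n x, U x -> (hs n x - h x) ^+ 2 <= g x) ->
  (forall x, U x -> ~ N x -> hs n x @[n --> \oo] --> h x) ->
  trig_approxR h.
Proof.
move=> negN ahs mh ig hg cvh; apply: trig_approx_lim; first exact: cmeas_real.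
move=> eps eps0.
have mhs n : measurable_fun U (hs n) by exact: trig_approxR_measurable.
have [] := @dominated_convergence _ _ _ mu U mU
    (fun n x => ((hs n x - h x) ^+ 2)%:E) (cst 0%E) (EFin \o g).
- move=> n; apply/measurable_EFinP; apply: measurable_funX.
  exact: measurable_funB (mhs n) mh.
- exact: measurable_cst.
- apply: negligibleS negN => x /= /not_implyP[Ux].
  apply: contra_notP => Nx; apply: cvg_EFin; first by apply: nearW => n /=; rewrite fin_numE.
  have /cvgrPdist_lt d := cvh x Ux Nx.
  apply/cvgr0Pnorm_lt => e e0.
  have se0 : 0 < Num.sqrt e by rewrite sqrtr_gt0.
  apply: filterS (d _ se0) => n /= ltn.
  rewrite ger0_norm ?sqr_ge0// -real_normK ?num_real// distrC.
  by rewrite -[ltRHS]sqr_sqrtr ?(ltW e0)// ltr_pXn2r// nnegrE ?sqrtr_ge0.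
- exact: ig.
- apply: aeW => x n Ux /=; rewrite lee_fin ger0_norm ?sqr_ge0//; exact: hg.
move=> _ _; rewrite integral0 => cv0.
(* The integrals of the squared errors tend to 0, so some index brings them below [eps]. *)
have nb : nbhs (0%E : \bar R) [set y | (y < eps%:E)%E].
  by apply: open_nbhs_nbhs; split; [exact: open_ereal_lt_ereal|rewrite /= lte_fin].
have [n _ /(_ n (leqnn n)) /= lt_eps] := cv0 _ nb.
exists (fun x => (hs n x)%:C%C); split; first exact: ahs.
rewrite (_ : L2norm2 _ _ = \int[mu]_(x in U) ((hs n x - h x) ^+ 2)%:E)%E//.
apply: eq_integral => x _; rewrite normc_sqr_realB -[(h x - _) ^+ 2]sqrrN opprB//.
Qed.

Let mu_U : (mu U < +oo)%E.
Proof. by rewrite lebesgue_measure_itv/= lte_fin ltr01 -EFinB ltry. Qed.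

Lemma trig_approxR_cst r : trig_approxR (fun=> r : R).
Proof. by apply: trig_approx_trig; exact: trig_cst. Qed.

Lemma trig_approxRD h1 h2 : trig_approxR h1 -> trig_approxR h2 ->
  trig_approxR (fun x => h1 x + h2 x).
Proof.
move=> a1 a2; rewrite /trig_approxR; under eq_fun do rewrite rmorphD.
exact: trig_approxD.
Qed.

Lemma trig_approxRZ r h : trig_approxR h -> trig_approxR (fun x => r * h x).
Proof.
move=> ah; rewrite /trig_approxR; under eq_fun do rewrite rmorphM.
exact: trig_approxZ.
Qed.

Lemma trig_approxR_sum I (s : seq I) (F : I -> R -> R) :
  (forall i, trig_approxR (F i)) -> trig_approxR (fun x => \sum_(i <- s) F i x).
Proof.
move=> aF; rewrite /trig_approxR; under eq_fun do rewrite rmorph_sum.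
exact: trig_approx_sum.
Qed.

Lemma eq_trig_approxR h1 h2 : {in U, h1 =1 h2} -> trig_approxR h1 ->
  trig_approxR h2.
Proof. by move=> h12; apply: eq_trig_approx => x xU; rewrite h12. Qed.

Let integrable_cst (r : R) : mu.-integrable U (EFin \o cst r).
Proof.
apply: measurable_bounded_integrable => //.
by exists `|r|; split => // M rM x _; exact: ltW.
Qed.

Lemma trig_real_1B h : trig (fun x => (h x)%:C%C) ->
  trig (fun x => (1 - h x)%:C%C).
Proof.
move=> th; rewrite (_ : (fun x => _) =
    (fun=> 1) + (-1) *: (fun x => (h x)%:C%C) :> (R -> R[i]^o)).
  by apply: trigD; [exact: trig_cst|exact: trigZ].
by apply/funext => x; apply: complex_ext; rewrite ?ReD ?ImD ?ReM ?ImM/=; ring.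
Qed.

Lemma trig_realX h n : trig (fun x => (h x)%:C%C) ->
  trig (fun x => ((h x) ^+ n)%:C%C).
Proof.
move=> th; rewrite (_ : (fun x => _) =
    (fun x => (h x)%:C%C ^+ n) :> (R -> R[i]^o)); first exact: trigX.
by apply/funext => x; rewrite rmorphXn.
Qed.

Lemma trig_real_half h : trig (fun x => (h x)%:C%C) ->
  trig (fun x => (h x / 2)%:C%C).
Proof.
move=> th; rewrite (_ : (fun x => _) =
    (2^-1)%:C%C *: (fun x => (h x)%:C%C) :> (R -> R[i]^o)); first exact: trigZ.
by apply/funext => x; apply: complex_ext; rewrite ?ReM ?ImM/=; ring.
Qed.

(** For [h] a shifted cosine and y = (1 - h) / 2, this is the step approximation evaluated at y. *)
Lemma trig_real_step h n m : trig (fun x => (h x)%:C%C) ->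
  trig (fun x => ((1 - ((1 - h x) / 2) ^+ n) ^+ m)%:C%C).
Proof.
by move=> th; apply: trig_realX; apply: trig_real_1B; apply: trig_realX;
  apply: trig_real_half; exact: trig_real_1B.
Qed.

(* [b / 2] is the centre of the arc (0, b) of the circle R/Z. *)
Lemma cos_arc (b x : R) : 0 < b < 1 -> 0 < x < 1 -> exists z,
  [/\ 0 <= z <= 1, cos (2 * pi * (x - b / 2)) = cos (pi * z),
      (z < b) = (x < b) & (b < z) = (b < x)].
Proof.
move=> /andP[b0 b1] /andP[x0 x1].
have -> : 2 * pi * (x - b / 2) = pi * (2 * x - b) by field.
(* The witness [z] is twice the distance from x to b / 2 on the circle. The cases are x before the
   centre, x at most half a turn after it, and x beyond that, where the short way round passes
   through 0. *)
have [xb|xb] := leP b (2 * x); last first.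
  exists (b - 2 * x); split; first (by apply/andP; split; lra);
    try (by apply/idP/idP; lra).
  by rewrite -cosN; congr cos; ring.
have [xle|xgt] := leP (2 * x - b) 1.
  exists (2 * x - b); split => //; first (by apply/andP; split; lra);
    by apply/idP/idP; lra.
exists (2 - (2 * x - b)); split; first (by apply/andP; split; lra);
  try (by apply/idP/idP; lra).
have -> : pi * (2 * x - b) = - (pi * (2 - (2 * x - b))) + pi *+ 2.
  by rewrite -[pi *+ 2]mulr_natr; ring.
by rewrite cosD2pi cosN.
Qed.

(** The cosine decreases on [0, pi], so comparing the cosines amounts to comparing [z] with [b],
    hence x with b: the arc is a sublevel set of y. *)
Lemma cos_arc_cmp (b x : R) : 0 < b < 1 -> 0 < x < 1 ->
  let y := (1 - cos (2 * pi * (x - b / 2))) / 2 in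
  let s := (1 - cos (pi * b)) / 2 in
  (y < s) = (x < b) /\ (s < y) = (b < x).
Proof.
move=> b01 x01 /=; have [z [/andP[z0 z1] -> <- <-]] := cos_arc b01 x01.
have /andP[b0 b1] := b01; have p0 := pi_gt0 R.
have mem (c : R) : 0 <= c -> c <= 1 -> pi * c \in `[0, pi]%R.
  by move=> c0 c1; rewrite in_itv/=; apply/andP; split; [exact: mulr_ge0 (ltW p0) c0|exact: ler_piMr (ltW p0) c1].
rewrite !ltr_pM2r ?invr_gt0// !ltrD2l !ltrN2.
by rewrite !ltr_cos ?ltr_pM2l// ?mem// ltW.
Qed.

Lemma trig_approx_ray b : trig_approxR (\1_(`]-oo, b[%classic : set R)).
Proof.
have [b0|b0] := leP b 0.
  apply: (eq_trig_approxR _ (trig_approxR_cst 0)) => x.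
  rewrite inE/= in_itv/= => /andP[x0 _]; rewrite indicE.
  rewrite memNset// set_itvE/=; apply/negP; rewrite -leNgt; lra.
have [b1|b1] := leP 1 b.
  apply: (eq_trig_approxR _ (trig_approxR_cst 1)) => x.
  rewrite inE/= in_itv/= => /andP[x0 x1]; rewrite indicE mem_set// set_itvE/=; lra.
pose y (x : R) := (1 - cos (2 * pi * (x - b / 2))) / 2.
pose s := (1 - cos (pi * b)) / 2.
have y01 x : 0 <= y x <= 1.
  have := cos_le1 (2 * pi * (x - b / 2)).
  have := cos_geN1 (2 * pi * (x - b / 2)); rewrite /y.
  by move=> *; apply/andP; split; lra.
have s0 : 0 < s.
  have p0 := pi_gt0 R.
  rewrite /s divr_gt0// subr_gt0 -[ltRHS]cos0 ltr_cos ?in_itv/= ?lexx ?pi_ge0//.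
    by rewrite mulr_gt0.
  apply/andP; split; [exact: mulr_ge0 (ltW p0) (ltW b0)|exact: ler_piMr (ltW p0) (ltW b1)].
have s1 : s <= 1 by have := cos_geN1 (pi * b); rewrite /s; lra.
(* The exceptional points are the ends of the arc, where y equals [s]. *)
apply: (@trig_approx_dominated ([set 0] `|` [set b])
    (fun n x => step_approx s n (y x)) _ (cst 1)).
- have neg1 (c : R) : mu.-negligible [set c].
    by exists [set c]; split => //; exact: lebesgue_measure_set1.
  exact: negligibleU.
- move=> n; apply: trig_approx_trig.
  by apply: trig_real_step; exact: trig_cos.
- exact: measurable_indic.
- exact: integrable_cst.
- move=> n x _ /=; have := step_approx_ge0 s n (y01 x).
  have := step_approx_le1 s n (y01 x); rewrite indicE.
  by case: (x \in _) => /=; nra.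
- move=> x; rewrite /= in_itv/= => /andP[x0 x1] nx.
  have xn0 : x != 0 by apply/eqP => xe; apply: nx; left.
  have xnb : x != b by apply/eqP => xe; apply: nx; right.
  have xgt0 : 0 < x by rewrite lt_neqAle eq_sym xn0.
  have b01 : 0 < b < 1 by apply/andP.
  have x01 : 0 < x < 1 by apply/andP.
  have /= [yE sE] := cos_arc_cmp b01 x01.
  have -> : \1_(`]-oo, b[%classic : set R) x = ((y x < s)%R%:R : R).
    rewrite indicE -/(y x) -/s yE; congr (nat_of_bool _)%:R; apply/idP/idP.
      by rewrite inE.
    by rewrite inE.
  apply: cvg_step_approx => //.
  apply: contra xnb => /eqP ys.
  by move: yE sE; rewrite -/(y x) -/s ys ltxx => /esym xb /esym bx; rewrite eq_le !leNgt xb bx.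
Qed.

Lemma sum_indic_trivIset (F : (set R)^nat) n x : trivIset setT F ->
  \sum_(i < n) \1_(F i) x = (x \in \bigcup_(i < n) F i)%:R :> R.
Proof.
move=> tF; have [[i /= ltin Fix]|nF] := pselect (exists2 i, (i < n)%N & F i x).
  rewrite [in RHS]mem_set; last by exists i.
  rewrite (bigD1 (Ordinal ltin))//= indicE mem_set// big1 ?addr0// => j ji.
  rewrite indicE memNset// => Fjx; move/eqP: ji; apply; apply/val_inj => /=.
  by apply: (tF (val j) i) => //; exists x.
rewrite [in RHS]memNset; last by move=> [i /= ltin Fix]; apply: nF; exists i.
rewrite big1// => j _; rewrite indicE memNset// => Fjx; apply: nF.
by exists (val j) => //; exact: ltn_ord.
Qed.

(** Dynkin's lemma: the open rays are stable under intersection and generate the Borel sets.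
    Complements pass through 1 minus the indicator, disjoint unions through dominated convergence of
    the partial sums. *)
Lemma trig_approx_indic (A : set R) : measurable A -> trig_approxR (\1_A).
Proof.
move=> mA.
have : (@RGenInftyO.G R).-sigma.-measurable A.
  by rewrite -RGenInftyO.measurableE; exact: mA.
apply: (@dynkin_induction _ (measurableTypeR R) (@RGenInftyO.G R)
  (fun A => trig_approxR (\1_A))).
- exact: RGenInftyO.measurableE.
- move=> _ _ [a ->] [b ->]; exists (Num.min a b).
  by apply/seteqP; split => x; rewrite /= !in_itv/= lt_min => /andP.
- by rewrite indicT; exact: trig_approxR_cst.
- by move=> _ [b ->]; exact: trig_approx_ray.
- move=> S mS aS; rewrite (_ : \1_(~` S) = fun x => 1 + (-1) * \1_S x).
    by apply: trig_approxRD; [exact: trig_approxR_cst|exact: trig_approxRZ].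
  apply/funext => x; rewrite indicC indicE.
  by case: (x \in S); rewrite /= ?mulr1 ?mulr0 ?subrr ?addr0.
- move=> F mF tF aF.
  apply: (@trig_approx_dominated set0
    (fun n x => \sum_(i < n) \1_(F i) x) _ (cst 1)).
  + exact: negligible_set0.
  + by move=> n; apply: trig_approxR_sum => i; exact: aF.
  + by apply: measurable_indic; exact: bigcupT_measurable.
  + exact: integrable_cst.
  + move=> n x _; rewrite sum_indic_trivIset// indicE /=.
    by case: (x \in _) => /=; case: (x \in _) => /=; lra.
  + move=> x _ _; rewrite indicE.
    (* The partial sums at a point are eventually 1 or constantly 0. *)
    have [[i _ Fix]|nF] := pselect ((\bigcup_k F k) x).
      rewrite mem_set; last by exists i.
      apply: (@cvg_trans _ ((fun=> 1 : R) @ \oo)); last exact: cvg_cst.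
      apply: near_eq_cvg; near=> n; rewrite sum_indic_trivIset// mem_set//.
      by exists i => //=; near: n; exact: nbhs_infty_gt.
    rewrite memNset// (_ : (fun n => _) = fun=> 0); first exact: cvg_cst.
    apply/funext => n; rewrite sum_indic_trivIset// memNset// => -[i _ Fix].
    by apply: nF; exists i.
Unshelve. all: by end_near. Qed.

Import HBNNSimple.

Lemma trig_approx_nnsfun (k : {nnsfun R >-> R}) : trig_approxR k.
Proof.
rewrite (_ : (k : R -> R) = fun x =>
    \sum_(y <- fset_set (range k)) y * \1_(k @^-1` [set y]) x); last first.
  by apply/funext => x; rewrite fimfunE fsbig_finite.
apply: trig_approxR_sum => y; apply: trig_approxRZ; apply: trig_approx_indic.
exact: measurable_sfunP.
Qed.

(** The standard simple functions lie between 0 and [h] and converge to it, so the squared errors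
    are dominated by the square of [h]. *)
Lemma trig_approx_nonneg h : measurable_fun U h -> (forall x, 0 <= h x) ->
  mu.-integrable U (EFin \o (fun x => h x ^+ 2)) -> trig_approxR h.
Proof.
move=> mh h0 ih; have mhE : measurable_fun U (EFin \o h) by exact/measurable_EFinP.
have hE0 x : U x -> (0 <= (EFin \o h) x)%E by move=> _; rewrite lee_fin.
apply: (@trig_approx_dominated set0 (fun n => nnsfun_approx mU mhE n) h
    (fun x => h x ^+ 2)) => //.
- exact: negligible_set0.
- by move=> n; exact: trig_approx_nnsfun.
- move=> n x Ux; have : nnsfun_approx mU mhE n x <= h x.
    by rewrite -lee_fin nnsfun_approxE; exact: le_approx.
  have : 0 <= nnsfun_approx mU mhE n x by [].
  by have := h0 x; nra.
- move=> x Ux _; have /fine_cvgP[_] := cvg_nnsfun_approx mU mhE hE0 Ux.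
  exact.
Qed.

Lemma trig_approx_real h : measurable_fun U h ->
  mu.-integrable U (EFin \o (fun x => h x ^+ 2)) -> trig_approxR h.
Proof.
move=> mh ih.
have half (k : R -> R) : measurable_fun U k -> (forall x, 0 <= k x) ->
    (forall x, k x ^+ 2 <= h x ^+ 2) -> trig_approxR k.
  move=> mk k0 kh; apply: trig_approx_nonneg => //.
  apply: le_integrable ih => //.
    by apply/measurable_EFinP; exact: measurable_funX.
  by move=> x _ /=; rewrite lee_fin !ger0_norm ?sqr_ge0.
rewrite (_ : h = fun x => Num.max (h x) 0 + (-1) * Num.max (- h x) 0); last first.
  by apply/funext => x; rewrite !maxEle; case: ifP; case: ifP; lra.
apply: trig_approxRD; last apply: trig_approxRZ; apply: half.
- exact: measurable_maxr.
- by move=> x; rewrite le_max lexx orbT.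
- by move=> x; rewrite maxEle; case: ifP; nra.
- by apply: measurable_maxr => //; exact: measurable_funN.
- by move=> x; rewrite le_max lexx orbT.
- by move=> x; rewrite maxEle; case: ifP; nra.
Qed.

Lemma trig_approx_L2 f : L2 U f -> trig_approx f.
Proof.
move=> Lf; have /(L2E _ _)[[m1 m2] _] := Lf.
have i2 := integrable_normc_sqr Lf.
rewrite (_ : f = fun x =>
    (complex.Re (f x))%:C%C + Complex 0 1 * (complex.Im (f x))%:C%C); last first.
  by apply/funext => x; apply: complex_ext; rewrite ?ReD ?ImD ?ReM ?ImM/=; ring.
apply: trig_approxD; last apply: trig_approxZ; apply: trig_approx_real => //.
- apply: le_integrable i2 => //.
    by apply/measurable_EFinP; exact: measurable_funX.
  move=> x _ /=; rewrite lee_fin !ger0_norm ?sqr_ge0// normc_sqr lerDl.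
  exact: sqr_ge0.
- apply: le_integrable i2 => //.
    by apply/measurable_EFinP; exact: measurable_funX.
  move=> x _ /=; rewrite lee_fin !ger0_norm ?sqr_ge0// normc_sqr lerDr.
  exact: sqr_ge0.
Qed.

Lemma L2_expo (D : set R) (a : R) : measurable D -> (mu D < +oo)%E ->
  L2 D (expo a).
Proof.
move=> mD muD; apply/L2E; split; first exact: cmeas_expo.
rewrite /L2norm2; under eq_integral do rewrite normc_expo expr1n.
by rewrite integral_cst// mul1e.
Qed.

Lemma Rintegral_expo (n : int) : n != 0 ->
  \int[mu]_(x in U) cos (2 * pi * n%:~R * x) = 0 /\
  \int[mu]_(x in U) sin (2 * pi * n%:~R * x) = 0.
Proof.
move=> n0; pose k : R := 2 * pi * n%:~R.
have k0 : k != 0 by rewrite /k mulf_neq0 ?intr_eq0// mulf_neq0// gt_eqF// pi_gt0.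
have kE : k = 2 * pi * n%:~R by [].
rewrite -kE; have [ck sk] := cos_sin_int R n; rewrite -kE in ck sk.
have dlin (x : R) : is_derive x 1 (fun x : R => k * x) k.
  rewrite -[X in is_derive _ _ _ X](mulr1 k).
  exact: (@is_deriveZ _ R^o R^o id k x 1 1).
have dsin (x : R) : is_derive x 1 (fun x : R => k^-1 * sin (k * x)) (cos (k * x)).
  have d := is_derive1_comp (is_derive_sin (k * x)) (dlin x).
  apply: is_derive_eq (@is_deriveZ _ R^o R^o _ k^-1 x 1 _ d) _.
  by rewrite /GRing.scale/= mulrCA mulVf// mulr1.
have dcos (x : R) : is_derive x 1 (fun x : R => - k^-1 * cos (k * x)) (sin (k * x)).
  have d := is_derive1_comp (is_derive_cos (k * x)) (dlin x).
  apply: is_derive_eq (@is_deriveZ _ R^o R^o _ (- k^-1) x 1 _ d) _.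
  by rewrite /GRing.scale/= !mulNr mulrN opprK mulrCA mulVf// mulr1.
have clin (x : R) : {for x, continuous (fun x : R => k * x)}.
  exact: mulrl_continuous.
(* The fundamental theorem of calculus is applied on [0, 1], which differs from [0, 1) by a null
   set. Both primitives agree at 0 and 1, as [k] is a whole number of periods. *)
have ftc (F f : R -> R) : (forall x : R, is_derive x 1 F (f x)) -> continuous f ->
    \int[mu]_(x in U) f x = F 1 - F 0.
  move=> dF cf; have cF (x : R) : {for x, continuous F}.
    by apply/differentiable_continuous/derivable1_diffP; case: (dF x).
  have ic : mu.-integrable `[0%R, 1%R] (EFin \o f).
    apply: continuous_compact_integrable; first exact: segment_compact.
    exact: continuous_subspaceT.
  have ico : mu.-integrable U (EFin \o f).
    by apply: integrableS ic => //; apply: subset_itvl; rewrite bnd_simp.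
  rewrite (Rintegral_itv_bndo_bndc ico).
  rewrite /Rintegral (@continuous_FTC2 _ f F)//.
  - exact: continuous_subspaceT.
  - split.
    + by move=> x _; case: (dF x).
    + by apply: cvg_at_right_filter; exact: cF.
    + by apply: cvg_at_left_filter; exact: cF.
  - by move=> x _; rewrite derive1E; apply: derive_val.
split.
- rewrite (ftc _ _ dsin).
    by rewrite mulr1 mulr0 sk sin0 !mulr0 subrr.
  by move=> x; apply: continuous_comp (clin x) _; exact: continuous_cos.
- rewrite (ftc _ _ dcos).
    by rewrite mulr1 mulr0 ck cos0 subrr.
  by move=> x; apply: continuous_comp (clin x) _; exact: continuous_sin.
Qed.

End Density.

(** * Unions of unit intervals *)

Section UnitInterval.
Variable R : realType.
Local Open Scope classical_set_scope.
Notation mu := (@lebesgue_measure R).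
Notation U := (`[0%R, 1%R[%classic : set R).

Let mU : measurable U. Proof. exact: measurable_itv. Qed.

Let mu_U1 : mu U = 1%E.
Proof. by rewrite lebesgue_measure_itv/= lte_fin ltr01 -EFinB subr0. Qed.

Notation e := (fun n : int => @expo R n%:~R).

Lemma L2_expo_int n : L2 U (e n).
Proof. by apply: L2_expo => //; rewrite mu_U1 ltry. Qed.

Lemma expo_orthonormal n m : L2_ip U (e n) (e m) = (n == m)%:R.
Proof.
rewrite /L2_ip.
have -> : (fun x => expo n%:~R x * conjc (expo m%:~R x)) = @expo R (n - m)%:~R.
  by apply/funext => x; rewrite -expoN -expoD intrB.
have [->|nm] := eqVneq n m.
  rewrite subrr mulr0z (_ : expo 0 = cst 1); last first.
    by apply/funext => x; rewrite expo0.
  apply: complex_ext => /=; rewrite Rintegral_cst// ?mul0r// mul1r.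
  by rewrite -[X in fine X]/(mu U) mu_U1.
have [|c s] := @Rintegral_expo R (n - m); first by rewrite subr_eq0.
by apply: complex_ext => /=; rewrite ?c ?s.
Qed.

(** Links density with the abstract [parseval]; a sum takes the union of the two frequency sets. *)
Lemma trig_in_span p : trig p ->
  exists s : {fset int}, in_span (L2 U) (L2_ip U) e s p.
Proof.
elim=> [n|{}p q _ [s [Lp sp]] _ [t [Lq tq]]|c {}p _ [s [Lp sp]]].
- exists [fset n]%fset; split; first exact: L2_expo_int.
  by move=> w Lw; apply; rewrite inE.
- exists (s `|` t)%fset; split; first exact: L2D.
  move=> w Lw w0; rewrite (@ipDr _ _ (L2 U)) ?sp ?tq ?addr0//.
  + by move=> k kt; apply: w0; rewrite inE kt orbT.
  + by move=> k ks; apply: w0; rewrite inE ks.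
  + exact: L2D.
  + exact: L2_ipDl.
  + exact: L2_ipC.
- exists s; split; first exact: L2Z.
  move=> w Lw w0; rewrite (@L2_ipC _ _ mU (c *: p) w)//; last exact: L2Z.
  by rewrite L2_ipZl// (@L2_ipC _ _ mU w p)// sp// conjc0 mulr0 conjc0.
Qed.

Lemma L2_parseval f : L2 U f ->
  \esum_(n in [set: int]) (normc (L2_ip U f (e n)) ^+ 2)%:E = L2norm2 U f.
Proof.
move=> Lf; rewrite -(EFin_ip_normsq_L2 Lf).
apply: (@parseval _ _ (L2 U)) => //.
- exact: L2_0.
- exact: L2D.
- exact: L2Z.
- exact: L2_ipDl.
- exact: L2_ipZl.
- exact: L2_ipC.
- by move=> *; exact: ip_normsq_L2_ge0.
- exact: L2_expo_int.
- exact: expo_orthonormal.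
- move=> eps eps0; have [mf /(_ _ eps0)[p [tp fp]]] := trig_approx_L2 Lf.
  have [s sp] := trig_in_span tp; exists s, p; split => //.
  rewrite -lte_fin EFin_ip_normsq_L2//; apply: L2D => //.
  by rewrite -scaleN1r; apply: L2Z => //; exact: sp.1.
Qed.

Lemma L2norm2_expo_sum (J : seq int) (c : int -> R[i]) : uniq J ->
  L2norm2 U (\sum_(n <- J) c n *: e n) = (\sum_(n <- J) normc (c n) ^+ 2)%:E.
Proof.
move=> uJ; rewrite -EFin_ip_normsq_L2.
  rewrite (@ip_normsq_orthonormal_sum _ _ (L2 U)) //.
  - exact: L2_0.
  - exact: L2D.
  - exact: L2Z.
  - exact: L2_ipDl.
  - exact: L2_ipZl.
  - exact: L2_ipC.
  - exact: L2_expo_int.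
  - exact: expo_orthonormal.
apply: (@H_sum _ _ (L2 U)).
- exact: L2_0.
- exact: L2D.
- by move=> n; apply: L2Z => //; exact: L2_expo_int.
Qed.

End UnitInterval.

(** * Translation invariance of the Lebesgue integral *)

Section Translation.
Variable R : realType.
Local Open Scope classical_set_scope.
Notation mu := (@lebesgue_measure R).
Notation U := (`[0%R, 1%R[%classic : set R).

Lemma preimage_translate (a : R) b1 b2 (c d : R) :
  (fun x => x + a) @^-1` [set` Interval (BSide b1 c) (BSide b2 d)] =
  [set` Interval (BSide b1 (c - a)) (BSide b2 (d - a))].
Proof.
apply/seteqP; split => x; rewrite /= !in_itv/=;
  by case: b1 b2 => -[]; rewrite /= ?lerBlDr ?ltrBlDr ?lerBrDr ?ltrBrDr.
Qed.

Let translate (a : R) : measurableTypeR R -> measurableTypeR R :=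
  fun x => (x + a)%R.

Let measurable_translate (a : R) : measurable_fun setT (translate a).
Proof. by apply: measurable_funD => //; exact: measurable_cst. Qed.

(** Lebesgue measure is determined by its values on half-open intervals, whose lengths a translation
    preserves. *)
Lemma lebesgue_measure_translate (a : R) (A : set R) : measurable A ->
  pushforward mu (translate a) A = mu A.
Proof.
move=> mA; apply/esym.
(* Packed as a measurable function so that the pushforward is recognised as a measure. *)
pose mt_mixin := isMeasurableFun.Build _ _ _ _ _ (measurable_translate a).
pose mt_pack : {mfun _ >-> _} := HB.pack (translate a) mt_mixin.
apply: (@lebesgue_measure_unique R (pushforward mu mt_pack)) => // _ [[b c]] _ <-.
rewrite /pushforward [X in _ = mu X](preimage_translate a false false b c).
rewrite !lebesgue_measure_itv/=.
by rewrite !lte_fin ltrD2r -!EFinD opprB addrA subrK.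
Qed.

Lemma ge0_integral_translate (a : R) (D : set R) (f : R -> \bar R) :
  measurable D -> measurable_fun D f -> (forall x, D x -> (0 <= f x)%E) ->
  (\int[mu]_(x in D) f x = \int[mu]_(x in (fun x => x + a)%R @^-1` D) f (x + a)%R)%E.
Proof.
move=> mD mf f0.
rewrite -(@ge0_integral_pushforward _ _ _ _ _ (translate a) _ _ D f)//.
- apply: eq_measure_integral => A mA _.
  exact: (esym (lebesgue_measure_translate a mA)).
- by move=> x; rewrite inE; exact: f0.
Qed.

Lemma integral_translate (a : R) (D : set R) (f : R -> \bar R) :
  measurable D -> measurable_fun D f ->
  (\int[mu]_(x in D) f x = \int[mu]_(x in (fun x => x + a)%R @^-1` D) f (x + a)%R)%E.
Proof.
move=> mD mf; rewrite integralE [RHS]integralE; congr (_ - _)%E.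
- rewrite (ge0_integral_translate a)//; last exact: measurable_funepos.
  by apply: eq_integral => x _; rewrite !unlock.
- rewrite (ge0_integral_translate a)//; last exact: measurable_funeneg.
  by apply: eq_integral => x _; rewrite !unlock.
Qed.

Lemma integral_unit_translate (a : R) (f : R -> \bar R) :
  measurable_fun `[a, a + 1[ f ->
  (\int[mu]_(x in `[a, (a + 1)%R[) f x = \int[mu]_(x in U) f (x + a)%R)%E.
Proof.
move=> mf; rewrite (integral_translate a)// preimage_translate subrr.
by rewrite addrAC subrr add0r.
Qed.

End Translation.

(** * Integrals over a union of unit intervals as integrals over [0, 1) *)

Section UnitIntervals.
Variables (R : realType) (M : nat) (a : nat -> int).
Hypothesis a_incr : forall k, (k.+1 < M)%N -> a k < a k.+1.
Local Open Scope classical_set_scope.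
Notation mu := (@lebesgue_measure R).
Notation U := (`[0%R, 1%R[%classic : set R).
Notation D := (unit_intervals R M a).
Let I (k : nat) : set R := `[(a k)%:~R, (a k)%:~R + 1[.

Let mU : measurable U. Proof. exact: measurable_itv. Qed.

Lemma unit_intervals_mono i j : (i < j)%N -> (j < M)%N -> a i < a j.
Proof.
elim: j => // j ih; rewrite ltnS leq_eqVlt => /predU1P[->|ij] jM.
  exact: a_incr.
by apply: lt_trans (ih ij (ltnW jM)) _; exact: a_incr.
Qed.

Lemma unit_intervals_inj i j : (i < M)%N -> (j < M)%N -> a i = a j -> i = j.
Proof.
move=> iM jM aij; case: (ltngtP i j) => // ij.
  by have := unit_intervals_mono ij jM; rewrite aij ltxx.
by have := unit_intervals_mono ij iM; rewrite aij ltxx.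
Qed.

Let mI k : measurable (I k). Proof. exact: measurable_itv. Qed.

Let DE : D = \big[setU/set0]_(k < M) I k.
Proof. exact: bigcup_mkord. Qed.

Lemma measurable_unit_intervals : measurable D.
Proof. by rewrite DE; exact: bigsetU_measurable. Qed.

Let ID k : (k < M)%N -> I k `<=` D.
Proof. by move=> kM x Ix; exists k. Qed.

Let trivI : trivIset [set` index_enum 'I_M] (fun k : 'I_M => I k).
Proof.
have disj (i j : 'I_M) : (i < j)%N -> I i `&` I j !=set0 -> False.
  move=> ij [x []]; rewrite /I /= !in_itv/= => /andP[_ h1] /andP[h2 _].
  have := unit_intervals_mono ij (ltn_ord j).
  (* Between integers, [a i < a j] means [a i + 1 <= a j]; being half-open, even adjacent intervals
     are disjoint. *)
  rewrite -lezD1 -(ler_int R) intrD => h3.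
  by have := lt_le_trans h1 (le_trans h3 h2); rewrite ltxx.
move=> i j _ _ ne; case: (ltngtP i j) => [ij|ji|/val_inj//].
  by case: (disj _ _ ij ne).
by case: (disj _ _ ji); rewrite setIC.
Qed.

Lemma cmeas_translate (k : 'I_M) (f : R -> R[i]) : cmeas D f ->
  cmeas U (fun x => f (x + (a k)%:~R)).
Proof.
have mt (g : R -> R) : measurable_fun D g ->
    measurable_fun U (fun x => g (x + (a k)%:~R)).
  move=> mg; apply: (@measurable_comp _ _ _ _ _ _ (I k) g).
  - exact: mI.
  - move=> _ [x /= + <-]; rewrite /I /= !in_itv/= => /andP[x0 x1].
    by apply/andP; split; lra.
  - by apply: measurable_funS mg; [exact: measurable_unit_intervals|exact: ID (ltn_ord k)].
  - by apply: measurable_funD => //; exact: measurable_cst.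
by move=> [m1 m2]; split; [exact: mt m1|exact: mt m2].
Qed.

Lemma integral_unit_intervals (g : R -> R) : measurable_fun D g ->
  (\int[mu]_(x in D) (g x)%:E =
   \sum_(k < M) \int[mu]_(x in U) (g (x + (a k)%:~R)%R)%:E)%E.
Proof.
move=> mg; rewrite DE integral_bigsetU_EFin//.
- apply: eq_bigr => k _; rewrite integral_unit_translate//.
  apply/measurable_EFinP; apply: measurable_funS mg.
    exact: measurable_unit_intervals.
  exact: ID (ltn_ord k).
- by move=> k; exact: mI.
- exact: index_enum_uniq.
- by rewrite -DE; exact/measurable_EFinP.
Qed.

Lemma L2norm2_unit_intervals f : cmeas D f ->
  L2norm2 D f =
  (\int[mu]_(x in U) (\sum_(k < M) normc (f (x + (a k)%:~R)) ^+ 2)%R%:E)%E.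
Proof.
move=> mf; rewrite /L2norm2 integral_unit_intervals; last first.
  exact: measurable_normc_sqr.
rewrite -ge0_integral_sum//.
- by apply: eq_integral => x _; rewrite sumEFin.
- move=> k; apply: measurable_normc_sqrE; exact: cmeas_translate.
- by move=> k x _; rewrite lee_fin sqr_ge0.
Qed.

Lemma integrable_translate (k : 'I_M) (g : R -> R) :
  mu.-integrable D (EFin \o g) ->
  mu.-integrable U (EFin \o (fun x => g (x + (a k)%:~R))).
Proof.
move=> ig; have ik : mu.-integrable (I k) (EFin \o g).
  apply: integrableS ig.
  - exact: measurable_unit_intervals.
  - exact: mI.
  - exact: ID (ltn_ord k).
have [mk fk] := integrableP _ _ _ ik; apply/integrableP; split.
  apply: (@measurable_comp _ _ _ _ _ _ (I k) (EFin \o g)).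
  - exact: mI.
  - move=> _ [x /= + <-]; rewrite /I /= !in_itv/= => /andP[x0 x1].
    by apply/andP; split; lra.
  - exact: mk.
  - by apply: measurable_funD => //; exact: measurable_cst.
move: fk; rewrite /I integral_unit_translate//.
exact: measurableT_comp.
Qed.

Lemma Rintegral_unit_intervals (g : R -> R) : mu.-integrable D (EFin \o g) ->
  \int[mu]_(x in D) g x =
  \int[mu]_(x in U) (\sum_(k < M) g (x + (a k)%:~R)).
Proof.
move=> ig; rewrite /Rintegral integral_unit_intervals; last first.
  by apply/measurable_EFinP; exact: measurable_int ig.
congr fine; rewrite -integral_sum//; last first.
  by move=> k; exact: (@integrable_translate k g ig).
by apply: eq_integral => x _; rewrite sumEFin.
Qed.

Lemma cintegral_unit_intervals (g : R -> R[i]) : cintegrable D g ->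
  cintegral D g = cintegral U (fun x => \sum_(k < M) g (x + (a k)%:~R)).
Proof.
move=> [i1 i2]; apply: complex_ext => /=.
- rewrite Rintegral_unit_intervals//.
  by apply: eq_Rintegral => x _; rewrite Re_sum.
- rewrite Rintegral_unit_intervals//.
  by apply: eq_Rintegral => x _; rewrite Im_sum.
Qed.

Lemma lebesgue_measure_unit_intervals : (mu D < +oo)%E.
Proof.
have := @integral_unit_intervals (fun=> 1) (measurable_cst _).
rewrite integral_cst; last exact: measurable_unit_intervals.
rewrite mul1e => ->; rewrite lte_sum_pinfty// => k _.
by rewrite integral_cst// mul1e -[X in (X < _)%E]/(mu U) lebesgue_measure_itv/= lte_fin ltr01 -EFinB ltry.
Qed.

End UnitIntervals.

(** * Frame bounds for finite matrices *)

Section FiniteFrames.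
Variables (R : realType) (n : nat).
Implicit Types (z w g : 'I_n -> R[i]) (G : 'I_n -> 'I_n -> R[i]).

Definition nrm2 z : R := \sum_k normc (z k) ^+ 2.

Lemma nrm2_ge0 z : 0 <= nrm2 z.
Proof. by apply: sumr_ge0 => k _; rewrite sqr_ge0. Qed.

Lemma nrm2_eq0 z : nrm2 z <= 0 -> forall k, z k = 0.
Proof.
move=> z0 k; apply: ComplexField.Normc.eq0_normc; apply/eqP.
rewrite -sqrf_eq0; apply/eqP; apply: le_anti; rewrite sqr_ge0 andbT.
by apply: le_trans z0; rewrite /nrm2 (bigD1 k)//= lerDl sumr_ge0// => j _; rewrite sqr_ge0.
Qed.

Lemma nrm2_Re z : nrm2 z = complex.Re (\sum_k z k * conjc (z k)).
Proof. by rewrite Re_sum; apply: eq_bigr => k _; rewrite mulc_conj. Qed.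

Lemma nrm2_gram G z :
  nrm2 (fun j => \sum_k G j k * z k) = complex.Re (\sum_k \sum_k'
    z k * conjc (z k') * \sum_j G j k * conjc (G j k')).
Proof.
rewrite nrm2_Re; congr complex.Re.
under eq_bigr => j _ do rewrite rmorph_sum/= big_distrlr/=.
rewrite exchange_big/=; apply: eq_bigr => k _.
rewrite exchange_big/=; apply: eq_bigr => k' _.
by rewrite mulr_sumr; apply: eq_bigr => j _; rewrite rmorphM/=; ring.
Qed.

(** Gershgorin's estimate: the diagonal of the Gram matrix yields [c * nrm2 z], and elsewhere |z_k|
    |z_k'| is at most the mean of the two squares. The n - 1 off-diagonal entries of a row are
    counted as n, the form that leads to M (1 - rho) and M (1 + rho). *)
Lemma nrm2_gram_bound G (c rho : R) : 0 <= rho ->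
  (forall k, \sum_j normc (G j k) ^+ 2 = c) ->
  (forall k k', k != k' -> normc (\sum_j G j k * conjc (G j k')) <= rho) ->
  forall z, `|nrm2 (fun j => \sum_k G j k * z k) - c * nrm2 z|
            <= n%:R * rho * nrm2 z.
Proof.
move=> rho0 diag off z; rewrite nrm2_gram.
have -> : \sum_k \sum_k' z k * conjc (z k') * (\sum_j G j k * conjc (G j k')) =
  \sum_k (c * normc (z k) ^+ 2)%:C%C +
  \sum_k \sum_(k' | k' != k) z k * conjc (z k') * (\sum_j G j k * conjc (G j k')).
  rewrite -big_split/=; apply: eq_bigr => k _; rewrite (bigD1 k)//=; congr (_ + _).
  rewrite mulc_conj; have -> : \sum_j G j k * conjc (G j k) = c%:C%C.
    apply: complex_ext.
      by rewrite Re_sum -(diag k); apply: eq_bigr => j _; rewrite mulc_conj.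
    by rewrite Im_sum big1// => j _; rewrite mulc_conj.
  by apply: complex_ext; rewrite ?ReM ?ImM/=; ring.
rewrite ReD Re_sum /= -mulr_sumr -/(nrm2 z) addrAC subrr add0r.
apply: le_trans (le_Re_normc _) _; apply: le_trans (le_normc_sum _ _ _) _.
have -> : n%:R * rho * nrm2 z =
    \sum_(k < n) \sum_(k' < n) rho * ((normc (z k) ^+ 2 + normc (z k') ^+ 2) / 2).
  under eq_bigr => k _ do rewrite -mulr_sumr -mulr_suml big_split/= sumr_const card_ord.
  rewrite -mulr_sumr -mulr_suml big_split/= sumr_const card_ord sumrMnl.
  by rewrite -/(nrm2 z) -[nrm2 z *+ n]mulr_natr; field.
apply: ler_sum => k _; apply: le_trans (le_normc_sum _ _ _) _.
(* The diagonal term on the right is nonnegative and is discarded. *)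
rewrite [leRHS](bigID (fun k' => k' != k))/= -[leLHS]addr0; apply: lerD.
  apply: ler_sum => k' kk'; rewrite !normcM normc_conj mulrC.
  apply: ler_pM; rewrite ?mulr_ge0 ?normc_ge0//; first by rewrite off// eq_sym.
  by have := sqr_ge0 (normc (z k) - normc (z k')); lra.
apply: sumr_ge0 => k' _; rewrite mulr_ge0// divr_ge0//.
by rewrite addr_ge0 ?sqr_ge0.
Qed.

(** Expansion of |t z - w|^2 >= 0. *)
Lemma nrm2_am_gm (t : R) z w :
  2 * t * complex.Re (\sum_k z k * conjc (w k)) <= t ^+ 2 * nrm2 z + nrm2 w.
Proof.
rewrite Re_sum /nrm2 !mulr_sumr -big_split/=; apply: ler_sum => k _.
rewrite ReM Re_conjc Im_conjc !normc_sqr.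
have := sqr_ge0 (t * complex.Re (z k) - complex.Re (w k)).
have := sqr_ge0 (t * complex.Im (z k) - complex.Im (w k)); nra.
Qed.

(** The adjoint identity: the inner product of G z with g is that of z with the adjoint of G applied
    to g. *)
Lemma adjoint_sum G z g :
  \sum_j (\sum_k G j k * z k) * conjc (g j) =
  \sum_k z k * conjc (\sum_j conjc (G j k) * g j).
Proof.
under eq_bigr => j _ do rewrite mulr_suml.
rewrite exchange_big/=; apply: eq_bigr => k _.
rewrite rmorph_sum mulr_sumr; apply: eq_bigr => j _.
by rewrite rmorphM/= conjcK; ring.
Qed.

Lemma injective_surjective G :
  (forall z, (forall j, \sum_k G j k * z k = 0) -> forall k, z k = 0) ->
  forall g, exists z, forall j, \sum_k G j k * z k = g j.
Proof.
move=> inj g; pose A : 'M[R[i]]_n := \matrix_(k, j) G j k.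
have uA : A \in unitmx.
  rewrite -row_free_unit; apply: inj_row_free => v vA0.
  apply/rowP => k; rewrite mxE; apply: (inj (v 0)) => j.
  have /rowP/(_ j) := vA0; rewrite !mxE => vA0j; rewrite -[RHS]vA0j.
  by apply: eq_bigr => i _; rewrite mxE mulrC.
exists ((\row_j g j *m invmx A) 0) => j.
have /rowP/(_ j) : (\row_j g j *m invmx A) *m A = \row_j g j by rewrite mulmxKV.
rewrite mxE => gj; apply: etrans (_ : _ = (\row_j g j) 0 j) _; last by rewrite mxE.
by rewrite -gj; apply: eq_bigr => i _; rewrite [A _ _]mxE mulrC.
Qed.

(** The square matrix G and its adjoint have the same singular values. The proof avoids them:
    [A > 0] makes G injective, hence onto, and [nrm2_am_gm] with a suitable [t] gives each bound. *)
Lemma adjoint_frame_bounds G (A B : R) : 0 < A -> 0 < B ->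
  (forall z, A * nrm2 z <= nrm2 (fun j => \sum_k G j k * z k) <= B * nrm2 z) ->
  forall g, A * nrm2 g <= nrm2 (fun k => \sum_j conjc (G j k) * g j) <= B * nrm2 g.
Proof.
move=> A0 B0 fG g; pose w k := \sum_j conjc (G j k) * g j.
rewrite -/(nrm2 w); apply/andP; split.
  have [z zg] : exists z, forall j, \sum_k G j k * z k = g j.
    apply: injective_surjective => z z0; apply: nrm2_eq0.
    have /andP[+ _] := fG z; rewrite {2}/nrm2 big1.
      by rewrite pmulr_rle0.
    by move=> j _; rewrite z0 ComplexField.Normc.normc0 expr0n.
  have ge : nrm2 g = complex.Re (\sum_k z k * conjc (w k)).
    rewrite -adjoint_sum nrm2_Re; congr complex.Re.
    by apply: eq_bigr => j _; rewrite zg.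
  have /andP[+ _] := fG z.
  have -> : nrm2 (fun j => \sum_k G j k * z k) = nrm2 g.
    by apply: eq_bigr => j _; rewrite zg.
  (* With g = G z, taking t = A gives 2 A |g|^2 <= A^2 |z|^2 + |w|^2 <= A |g|^2 + |w|^2. *)
  by have := nrm2_am_gm A z w; rewrite -ge; nra.
have we : nrm2 w = complex.Re (\sum_j (\sum_k G j k * w k) * conjc (g j)).
  by rewrite adjoint_sum nrm2_Re.
have /andP[_ Bw] := fG w.
(* Taking t = 1 / B gives 2 |w|^2 / B <= |G w|^2 / B^2 + |g|^2 <= |w|^2 / B + |g|^2. *)
have := nrm2_am_gm B^-1 (fun j => \sum_k G j k * w k) g; rewrite -we => h.
have : B^-1 ^+ 2 * nrm2 (fun j => \sum_k G j k * w k) <= B^-1 ^+ 2 * (B * nrm2 w).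
  by apply: ler_wpM2l => //; exact: sqr_ge0.
have -> : B^-1 ^+ 2 * (B * nrm2 w) = B^-1 * nrm2 w by field; rewrite gt_eqF.
move=> h2; have h3 : B^-1 * nrm2 w <= nrm2 g by lra.
by have := ler_wpM2l (ltW B0) h3; rewrite mulVKf// gt_eqF.
Qed.

End FiniteFrames.

(** * Dirichlet kernels and distances to the integers *)

Section DirichletKernel.
Variable R : realType.
Implicit Types (t x y : R).

Lemma normc_expo_sub1 t : normc (expo 1 t - 1) = 2 * `|sin (pi * t)|.
Proof.
apply/eqP; rewrite -(@eqrXn2 _ 2) ?normc_ge0 ?mulr_ge0//.
rewrite normc_sqr ReD ImD ReN ImN exprMn real_normK ?num_real//= mulr1.
have -> : 2 * pi * t = (pi * t) *+ 2 by rewrite -[RHS]mulr_natr; ring.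
rewrite cos_mulr2n sin_mulr2n subr0.
have := cos2Dsin2 (pi * t).
set c := cos _; set s := sin _ => cs.
rewrite -[c ^+ 2 *+ 2]mulr_natr -[(c * s) *+ 2]mulr_natr; apply/eqP.
have -> : c ^+ 2 = 1 - s ^+ 2 by rewrite -cs; ring.
transitivity (4 * s ^+ 2 * (c ^+ 2 + s ^+ 2)); last by rewrite cs; ring.
by ring.
Qed.

Lemma expo_exp (j : nat) t : expo j%:R t = expo 1 t ^+ j.
Proof.
elim: j => [|j ih]; first by rewrite expo0 expr0.
by rewrite -natr1 addrC expoD ih exprS.
Qed.

Lemma expo_mulC (j : nat) t : expo 1 t ^+ j = expo 1 (j%:R * t).
Proof. by rewrite -expo_exp /expo mulr1 mulrA. Qed.

(** The geometric sum, with both differences from 1 read as chords of the unit circle. The product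
    form also covers integral t, where the sine vanishes. *)
Lemma normc_dirichlet (M : nat) t :
  normc (\sum_(j < M) expo j%:R t) * `|sin (pi * t)| = `|sin (pi * (M%:R * t))|.
Proof.
have n2 : (2 : R) != 0 by [].
apply: (mulfI n2).
rewrite mulrCA -normc_expo_sub1 -normc_expo_sub1 -normcM -expo_mulC.
congr normc; rewrite subrX1 mulrC; congr (_ * _).
by apply: eq_bigr => j _; rewrite expo_exp.
Qed.

(** The nearest integer is the floor of t + 1/2. Any other integer is at distance at least 1 from
    it, hence at least 1/2 from t. *)
Lemma dist_intE t : exists m : int,
  dist_int t = `|t - m%:~R| /\ `|t - m%:~R| <= 1 / 2.
Proof.
pose m := Num.floor (t + 1 / 2); exists m.
have := floor_itv (t + 1 / 2); rewrite -/m intrD => /andP[m1 m2].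
have le_half : `|t - m%:~R| <= 1 / 2 by rewrite ler_norml; apply/andP; split; lra.
split => //; apply: le_anti; apply/andP; split.
  apply: ge_inf; last by exists m.
  by exists 0 => _ [k _ <-].
apply: lb_le_inf; first by exists `|t - m%:~R|, m.
move=> _ [k _ <-]; have [->//|km] := eqVneq k m.
have : 1 <= `|k - m|%:~R :> R.
  by rewrite -[1]/(1%:~R) ler_int -gtz0_ge1 normr_gt0 subr_eq0.
rewrite intr_norm intrB => h; apply: (le_trans le_half).
have := ler_normB (t - m%:~R) (t - k%:~R).
have -> : t - m%:~R - (t - k%:~R) = k%:~R - m%:~R by ring.
by lra.
Qed.

Lemma dist_int_ge0 t : 0 <= dist_int t.
Proof. by have [m [-> _]] := dist_intE t. Qed.

Lemma dist_int_le_half t : dist_int t <= 1 / 2.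
Proof. by have [m [-> le]] := dist_intE t. Qed.

(** The distance is p / N for a natural number p with 2 p <= N, and oddness improves this to 2 p <=
    N - 1. *)
Lemma dist_int_odd (N : nat) (d : int) : odd N ->
  dist_int (d%:~R / N%:R : R) <= 1 / 2 - 1 / (2 * N%:R).
Proof.
move=> oddN; have N0 : (0 < N)%N by case: N oddN.
have N0r : 0 < N%:R :> R by rewrite ltr0n.
have [m [-> le]] := dist_intE (d%:~R / N%:R : R).
have E : `|d%:~R / N%:R - m%:~R| = (absz (d - m * N%:Z)%R)%:R / N%:R :> R.
  have -> : d%:~R / N%:R - m%:~R = (d - m * N%:Z)%:~R / N%:R :> R.
    by rewrite intrB intrM; field; rewrite gt_eqF.
  by rewrite normrM normfV (ger0_norm (ltW N0r)) -intr_norm natr_absz.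
move: le; rewrite E; set p := absz _ => le.
have : (2 * p <= N)%N.
  by rewrite -(ler_nat R) natrM; move: le; rewrite ler_pdivrMr//; lra.
move=> p2; have {}p2 : (2 * p + 1 <= N)%N by lia.
move: p2; rewrite -(ler_nat R) natrD natrM => p2.
rewrite ler_pdivrMr// mulrBl.
have -> : 1 / (2 * N%:R) * N%:R = 1 / 2 :> R by field; rewrite gt_eqF.
by lra.
Qed.

Lemma norm_sin_dist_int t : `|sin (pi * t)| = sin (pi * dist_int t).
Proof.
have [m [-> le]] := dist_intE t; have p0 := pi_gt0 R.
have -> : `|sin (pi * t)| = `|sin (pi * (t - m%:~R))|.
  apply/eqP; rewrite -(@eqrXn2 _ 2)// !real_normK ?num_real//.
  have [c s] := cos_sin_int R m.
  (* Squaring replaces the sine of pi t by the cosine of 2 pi t, which has period 1 in t and absorbs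
     [m]. *)
  have half x : sin x ^+ 2 = (1 - cos (x *+ 2)) / 2 :> R.
    by rewrite cos_mulr2n -[cos x ^+ 2 *+ 2]mulr_natr cos2sin2; field.
  rewrite !half; apply/eqP; congr ((1 - _) / 2).
  have -> : (pi * (t - m%:~R)) *+ 2 = (pi * t) *+ 2 - 2 * pi * m%:~R.
    by rewrite -[LHS]mulr_natr -[(pi * t) *+ 2]mulr_natr; ring.
  by rewrite cosB c s mulr1 mulr0 addr0.
have -> : `|sin (pi * (t - m%:~R))| = `|sin (pi * `|t - m%:~R|)|.
  have [ge0|lt0] := ger0P (t - m%:~R) => //.
  by rewrite mulrN sinN normrN.
rewrite ger0_norm// sin_ge0_pi// mulr_ge0 ?(ltW p0)//= ler_piMr ?(ltW p0)//.
by lra.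
Qed.

(* [sin (pi (x - delta)) / sin (pi x)] is increasing in [x] *)
Lemma sin_ratio_le (X x y delta : R) : 0 < delta -> 0 <= y -> x <= X ->
  X <= 1 / 2 -> delta < x - y ->
  sin (pi * y) * sin (pi * X) <= sin (pi * (X - delta)) * sin (pi * x).
Proof.
move=> d0 y0 xX X2 dxy; have p0 := pi_gt0 R.
have sX : 0 <= sin (pi * X).
  apply: sin_ge0_pi; rewrite mulr_ge0 ?(ltW p0)//=; last by lra.
  rewrite ler_piMr ?(ltW p0)//; lra.
(* First y is raised to x - delta, the sine being increasing there. *)
apply: (@le_trans _ _ (sin (pi * (x - delta)) * sin (pi * X))).
  apply: ler_wpM2r => //; rewrite le_eqVlt; apply/orP; right.
  rewrite ltr_sin ?ltr_pM2l//; first lra.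
  - rewrite in_itv/=; apply/andP; split; nra.
  - rewrite in_itv/=; apply/andP; split; nra.
have -> : pi * (x - delta) = pi * x - pi * delta by ring.
have -> : pi * (X - delta) = pi * X - pi * delta by ring.
rewrite !sinB -subr_ge0.
(* What remains is sin (pi delta) sin (pi (X - x)), a product of nonnegative factors. *)
have -> : (sin (pi * X) * cos (pi * delta) - cos (pi * X) * sin (pi * delta)) * sin (pi * x) -
  (sin (pi * x) * cos (pi * delta) - cos (pi * x) * sin (pi * delta)) * sin (pi * X)
  = sin (pi * delta) * (sin (pi * X) * cos (pi * x) - cos (pi * X) * sin (pi * x)) by ring.
rewrite -sinB; apply: mulr_ge0; apply: sin_ge0_pi.
  by rewrite mulr_ge0 ?(ltW p0) ?(ltW d0)//= ler_piMr ?(ltW p0)//; lra.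
by rewrite -mulrBr mulr_ge0 ?(ltW p0) ?subr_ge0//= ler_piMr ?(ltW p0)//; lra.
Qed.

End DirichletKernel.

(** * The exponential system *)

Section FrameBounds.
Variables (R : realType) (N M u : nat) (a : nat -> int).
Hypothesis M2 : (2 < M)%N.
Hypothesis N0 : (0 < N)%N.
Hypothesis u0 : (0 < u)%N.
Hypothesis a_incr : forall k, (k.+1 < M)%N -> a k < a k.+1.
Hypothesis a_sep : forall k k' : nat, (k < M)%N -> (k' < M)%N -> a k <> a k' ->
  dist_int ((a k - a k')%:~R / N%:R : R)
    - dist_int ((a k - a k')%:~R * M%:R / N%:R : R) > u%:R / N%:R.
Local Open Scope classical_set_scope.
Notation mu := (@lebesgue_measure R).
Notation U := (`[0%R, 1%R[%classic : set R).
Notation D := (unit_intervals R M a).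

Let N0r : 0 < N%:R :> R. Proof. by rewrite ltr0n. Qed.

Let mU : measurable U. Proof. exact: measurable_itv. Qed.

Let mD : measurable D. Proof. exact: measurable_unit_intervals. Qed.

(** The matrix G; the conjugate comes from the second argument of the inner product. *)
Definition phase (j k : 'I_M) : R[i] := conjc (expo (j%:R / N%:R) ((a k)%:~R : R)).

(* [1/2 - parity_gap] is the largest distance to the integers of a fraction
   with denominator [N] *)
Definition parity_gap : R := if odd N then 1 / (2 * N%:R) else 0.

(** The constant rho for both parities: for even [N] the gap is 0 and the denominator is cos 0 =
    1. *)
Definition overlap : R :=
  cos (pi * parity_gap + pi * u%:R / N%:R) / cos (pi * parity_gap).

Let delta : R := u%:R / N%:R.

Let delta_gt0 : 0 < delta. Proof. by rewrite divr_gt0// ltr0n. Qed.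

Lemma dist_int_le_gap (d : int) : dist_int (d%:~R / N%:R : R) <= 1 / 2 - parity_gap.
Proof.
rewrite /parity_gap; case: ifPn => [oN|_]; first exact: dist_int_odd.
by rewrite subr0; exact: dist_int_le_half.
Qed.

Lemma parity_gap_ge0 : 0 <= parity_gap.
Proof. by rewrite /parity_gap; case: ifP => // _; rewrite divr_ge0// mulr_ge0// ltW. Qed.

(** The separation of [a 0] from [a 1] already forces this. It keeps the angles in [overlap] below
    pi / 2, where the cosine is positive and decreasing. *)
Lemma separation_lt_gap : delta < 1 / 2 - parity_gap.
Proof.
have M0 : (0 < M)%N by exact: leq_trans M2.
have M1 : (1 < M)%N by exact: leq_trans M2.
have ne : a 0%N <> a 1%N by move/(unit_intervals_inj a_incr M0 M1).
have := a_sep M0 M1 ne; have := dist_int_le_gap (a 0%N - a 1%N).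
have := dist_int_ge0 ((a 0%N - a 1%N)%:~R * M%:R / N%:R : R).
rewrite -/delta; lra.
Qed.

Let pi0 : 0 < pi :> R. Proof. exact: pi_gt0. Qed.

Let gap_angles : [/\ 0 <= pi * parity_gap, 0 < pi * delta &
  pi * parity_gap + pi * delta < pi / 2].
Proof.
split; first by rewrite mulr_ge0 ?parity_gap_ge0// ltW.
  by rewrite mulr_gt0.
by rewrite -mulrDr ltr_pM2l//; have := separation_lt_gap; lra.
Qed.

Lemma cos_gap_gt0 : 0 < cos (pi * parity_gap).
Proof.
have [h1 h2 h3] := gap_angles.
by apply: cos_gt0_pihalf; apply/andP; split; lra.
Qed.

Let deltaE : pi * u%:R / N%:R = pi * delta.
Proof. by rewrite /delta mulrA. Qed.

Lemma overlap_ge0 : 0 <= overlap.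
Proof.
have [h1 h2 h3] := gap_angles.
rewrite /overlap divr_ge0 ?(ltW cos_gap_gt0)// deltaE.
by apply: cos_ge0_pihalf; apply/andP; split; lra.
Qed.

Lemma overlap_lt1 : overlap < 1.
Proof.
have [h1 h2 h3] := gap_angles.
rewrite /overlap ltr_pdivrMr ?cos_gap_gt0// mul1r deltaE ltr_cos ?in_itv/=.
- by rewrite ltrDl.
- by apply/andP; split; lra.
- by apply/andP; split; lra.
Qed.

Lemma phase_gram_le (k k' : 'I_M) : k != k' ->
  normc (\sum_j phase j k * conjc (phase j k')) <= overlap.
Proof.
move=> kk'; set t : R := (a k' - a k)%:~R / N%:R.
have -> : \sum_j phase j k * conjc (phase j k') = \sum_(j < M) expo j%:R t.
  apply: eq_bigr => j _; rewrite /phase conjcK -expoN.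
  have -> : expo (- (j%:R / N%:R)) (a k)%:~R = expo (j%:R / N%:R) (- (a k)%:~R : R).
    by rewrite /expo !mulrN mulNr.
  rewrite -expoDr /expo /t intrB.
  have -> : 2 * pi * (j%:R / N%:R) * (- (a k)%:~R + (a k')%:~R) =
      2 * pi * j%:R * (((a k')%:~R - (a k)%:~R) / N%:R) :> R by ring.
  by [].
have ne : a k' <> a k.
  move=> /(unit_intervals_inj a_incr (ltn_ord k') (ltn_ord k)) /val_inj e.
  by rewrite e eqxx in kk'.
have := a_sep (ltn_ord k') (ltn_ord k) ne; rewrite -/t -/delta.
have -> : (a k' - a k)%:~R * M%:R / N%:R = M%:R * t by rewrite /t; ring.
have xle : dist_int t <= 1 / 2 - parity_gap by exact: dist_int_le_gap.
have y0 := dist_int_ge0 (M%:R * t); have := normc_dirichlet M t.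
rewrite !norm_sin_dist_int; set x := dist_int t in xle *; set y := dist_int _ in y0 *.
move=> E dxy; have g0 := parity_gap_ge0; have d0 := delta_gt0.
have X2 : 1 / 2 - parity_gap <= 1 / 2 :> R by lra.
(* The kernel is sin (pi y) / sin (pi x) with x > y + delta; its bound is worst at the largest
   possible x, namely 1/2 - [parity_gap], where the sines become the cosines of [overlap]. *)
have := sin_ratio_le d0 y0 xle X2 dxy.
have sx : 0 < sin (pi * x).
  apply: sin_gt0_pi; rewrite mulr_gt0//=; last lra.
  by rewrite gtr_pMr//; lra.
have -> : sin (pi * (1 / 2 - parity_gap)) = cos (pi * parity_gap).
  have -> : pi * (1 / 2 - parity_gap) = - (pi * parity_gap) + pi / 2 by ring.
  by rewrite sinDpihalf cosN.
have -> : sin (pi * (1 / 2 - parity_gap - delta)) = cos (pi * parity_gap + pi * delta).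
  have -> : pi * (1 / 2 - parity_gap - delta) = - (pi * parity_gap + pi * delta) + pi / 2.
    by ring.
  by rewrite sinDpihalf cosN.
rewrite -E /overlap deltaE ler_pdivlMr ?cos_gap_gt0// => h.
by rewrite -(ler_pM2r sx) mulrAC.
Qed.

Let A : R := M%:R * (1 - overlap).
Let B : R := M%:R * (1 + overlap).

Let M0r : 0 < M%:R :> R. Proof. by rewrite ltr0n; exact: leq_trans M2. Qed.

Let A0 : 0 < A.
Proof. by rewrite mulr_gt0// subr_gt0 overlap_lt1. Qed.

Let B0 : 0 < B.
Proof. by rewrite mulr_gt0// ltr_pwDl// overlap_ge0. Qed.

Lemma phase_frame z :
  A * nrm2 z <= nrm2 (fun j => \sum_k phase j k * z k) <= B * nrm2 z.
Proof.
have diag k : \sum_j normc (phase j k) ^+ 2 = M%:R.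
  under eq_bigr do rewrite /phase normc_conj normc_expo expr1n.
  by rewrite sumr_const card_ord.
have := nrm2_gram_bound overlap_ge0 diag phase_gram_le z.
rewrite ler_distl => /andP[h1 h2]; rewrite /A /B.
by apply/andP; split; lra.
Qed.

Lemma phase_adjoint_frame g :
  A * nrm2 g <= nrm2 (fun k => \sum_j conjc (phase j k) * g j) <= B * nrm2 g.
Proof. exact: adjoint_frame_bounds phase_frame g. Qed.

(** Since exp(2 pi i n a_k) = 1, translation by [a k] produces a factor independent of [n]. *)
Lemma exp_system_translate (j k : 'I_M) (n : int) (x : R) :
  exp_system R N M (j, n) (x + (a k)%:~R) =
  conjc (phase j k) * (expo (j%:R / N%:R) x * expo n%:~R x).
Proof.
rewrite /exp_system expoD !expoDr expo_int /phase conjcK; ring.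
Qed.

Notation e := (fun n : int => @expo R n%:~R).
Notation sys := (exp_system R N M).

Lemma L2_exp_system (p : 'I_M * int) : L2 D (sys p).
Proof. by apply: L2_expo => //; exact: lebesgue_measure_unit_intervals. Qed.

Lemma cmeas_nrm2 (F : 'I_M -> R -> R[i]) : (forall j, cmeas U (F j)) ->
  measurable_fun U (fun x => (nrm2 (F ^~ x))%:E).
Proof.
move=> mF; apply/measurable_EFinP; apply: measurable_sum => j.
exact: measurable_normc_sqr.
Qed.

Lemma sum_L2norm2 (F : 'I_M -> R -> R[i]) : (forall j, cmeas U (F j)) ->
  (\sum_j L2norm2 U (F j) = \int[mu]_(x in U) (nrm2 (F ^~ x))%:E)%E.
Proof.
move=> mF; rewrite /L2norm2 -ge0_integral_sum//.
- by apply: eq_integral => x _; rewrite sumEFin.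
- by move=> j; exact: measurable_normc_sqrE.
- by move=> j x _; rewrite lee_fin sqr_ge0.
Qed.

Lemma integral_nrm2_bounds (F G : 'I_M -> R -> R[i]) :
  (forall j, cmeas U (F j)) -> (forall j, cmeas U (G j)) ->
  (forall x, A * nrm2 (F ^~ x) <= nrm2 (G ^~ x) <= B * nrm2 (F ^~ x)) ->
  (A%:E * \int[mu]_(x in U) (nrm2 (F ^~ x))%:E
     <= \int[mu]_(x in U) (nrm2 (G ^~ x))%:E
     <= B%:E * \int[mu]_(x in U) (nrm2 (F ^~ x))%:E)%E.
Proof.
move=> mF mG FG; have nF x : U x -> (0 <= (nrm2 (F ^~ x))%:E)%E.
  by move=> _; rewrite lee_fin nrm2_ge0.
rewrite -!ge0_integralZl ?lee_fin ?(ltW A0) ?(ltW B0)//; try exact: cmeas_nrm2.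
apply/andP; split; apply: ge0_le_integral => //.
- by move=> x _; rewrite -EFinM lee_fin mulr_ge0 ?nrm2_ge0 ?(ltW A0).
- by apply: measurable_funeM; exact: cmeas_nrm2.
- exact: cmeas_nrm2.
- by move=> x _; rewrite -EFinM lee_fin; case/andP: (FG x).
- by move=> x _; rewrite lee_fin nrm2_ge0.
- exact: cmeas_nrm2.
- by apply: measurable_funeM; exact: cmeas_nrm2.
- by move=> x _; rewrite -EFinM lee_fin; case/andP: (FG x).
Qed.

Lemma riesz_sequence (J : {fset 'I_M * int}) (c : 'I_M * int -> R[i]) :
  A * (\sum_(p <- J) normc (c p) ^+ 2)
    <= ip_normsq (L2_ip D) (\sum_(p <- J) c p *: sys p)
    <= B * (\sum_(p <- J) normc (c p) ^+ 2).
Proof.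
set f : R -> R[i]^o := \sum_(p <- J) c p *: sys p.
have Lf : L2 D f.
  apply: (@H_sum _ _ (L2 D)); [exact: L2_0|exact: L2D|].
  by move=> p; apply: L2Z => //; exact: L2_exp_system.
have /(L2E _ _)[mf _] := Lf.
(* The combination is grouped by [j]: [P_ j] collects the integer frequencies, and [g_ j] is its
   modulation by j / N. On the k-th interval f is then the k-th entry of the adjoint of G applied to
   [g_]. *)
pose J_ (j : 'I_M) : seq int := [seq p.2 | p <- J & p.1 == j].
pose P_ (j : 'I_M) : R -> R[i]^o := \sum_(n <- J_ j) c (j, n) *: e n.
pose g_ (j : 'I_M) : R -> R[i] := fun x => expo (j%:R / N%:R) x * P_ j x.
have uJ j : uniq (J_ j).
  rewrite map_inj_in_uniq; first exact/filter_uniq/fset_uniq.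
  move=> -[i n] [i' n'].
  by rewrite !mem_filter/= => /andP[/eqP -> _] /andP[/eqP -> _] ->.
have mP j : cmeas U (P_ j).
  have : L2 U (P_ j).
    apply: (@H_sum _ _ (L2 U)); [exact: L2_0|exact: L2D|].
    by move=> n; apply: L2Z => //; exact: L2_expo_int.
  by case/(L2E _ _).
have mg j : cmeas U (g_ j) by apply: cmeasM => //; exact: cmeas_expo.
have fE (k : 'I_M) x : f (x + (a k)%:~R) = \sum_j conjc (phase j k) * g_ j x.
  rewrite /f fct_sumE (partition_big (fun p => p.1) predT)//=.
  apply: eq_bigr => j _; rewrite /g_ /P_ fct_sumE /J_ big_map big_filter.
  rewrite !mulr_sumr; apply: eq_bigr => -[i n] /= /eqP ->.
  rewrite -[LHS]/(c (j, n) * sys (j, n) (x + (a k)%:~R)) exp_system_translate.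
  rewrite -[(c (j, n) *: e n) x]/(c (j, n) * expo n%:~R x).
  by rewrite [LHS]mulrCA; congr (_ * _); exact: mulrCA.
(* Modulation has modulus 1, so orthonormality on [0, 1) recovers the coefficients of each
   [P_ j]. *)
have gE : (\int[mu]_(x in U) (nrm2 (g_ ^~ x))%:E)%E =
    (\sum_(p <- J) normc (c p) ^+ 2)%:E.
  rewrite -sum_L2norm2// (partition_big (fun p => p.1) predT)//= -sumEFin.
  apply: eq_bigr => j _.
  rewrite (_ : L2norm2 U (g_ j) = L2norm2 U (P_ j)); last first.
    by apply: eq_integral => x _; rewrite /g_ normcM normc_expo mul1r.
  rewrite L2norm2_expo_sum// /J_ big_map big_filter; congr EFin.
  by apply: eq_bigr => -[i n] /= /eqP ->.
rewrite -2!lee_fin EFin_ip_normsq_L2// L2norm2_unit_intervals//.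
rewrite !EFinM -gE; apply: integral_nrm2_bounds => //.
  by move=> k; exact: cmeas_translate.
move=> x; have := phase_adjoint_frame (g_ ^~ x).
rewrite (_ : nrm2 (fun k => \sum_j conjc (phase j k) * g_ j x) =
    nrm2 (fun k : 'I_M => f (x + (a k)%:~R)))//.
by apply: eq_bigr => k _; rewrite fE.
Qed.

Lemma esum_ord (f : 'I_M -> \bar R) : (forall j, (0 <= f j)%E) ->
  (\esum_(j in [set: 'I_M]) f j = \sum_j f j)%E.
Proof.
move=> f0; rewrite esum_fset//; [|exact: finite_finset].
rewrite [RHS]fsbig_seq ?index_enum_uniq//.
rewrite (_ : [set` index_enum 'I_M] = [set: 'I_M])//.
by apply/seteqP; split => j _ //=; exact: mem_index_enum.
Qed.

Lemma esum_pairs (f : 'I_M * int -> \bar R) : (forall p, (0 <= f p)%E) ->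
  (\esum_(p in [set: 'I_M * int]) f p =
   \sum_j \esum_(n in [set: int]) f (j, n))%E.
Proof.
move=> f0; rewrite -esum_ord; last by move=> j; apply: esum_ge0.
rewrite esum_esum//; congr esum; first by apply/seteqP; split => p.
by apply/funext => -[].
Qed.

Lemma frame_bounds w : L2 D w ->
  ((A * ip_normsq (L2_ip D) w)%:E
     <= \esum_(p in [set: 'I_M * int]) (normc (L2_ip D w (sys p)) ^+ 2)%:E
     <= (B * ip_normsq (L2_ip D) w)%:E)%E.
Proof.
move=> Lw; have /(L2E _ _)[mw w2] := Lw.
pose z_ (k : 'I_M) (x : R) := w (x + (a k)%:~R).
have mz k : cmeas U (z_ k) by exact: (cmeas_translate k mw).
(* The j-th entry of G applied to the translates of w, demodulated so that its n-th Fourier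
   coefficient on [0, 1) is the inner product of w with the exponential of index (j, n). *)
pose W (j : 'I_M) (x : R) : R[i] :=
  conjc (expo (j%:R / N%:R) x) * \sum_k phase j k * z_ k x.
have mW j : cmeas U (W j).
  apply: cmeasM; first by apply: cmeas_conj; exact: cmeas_expo.
  by apply: cmeas_sum => k; exact: cmeasZ.
have bW : (A%:E * \int[mu]_(x in U) (nrm2 (z_ ^~ x))%:E
     <= \int[mu]_(x in U) (nrm2 (W ^~ x))%:E
     <= B%:E * \int[mu]_(x in U) (nrm2 (z_ ^~ x))%:E)%E.
  apply: integral_nrm2_bounds => // x; have := phase_frame (z_ ^~ x).
  rewrite (_ : nrm2 (fun j => \sum_k phase j k * z_ k x) = nrm2 (W ^~ x))//.
  by apply: eq_bigr => j _; rewrite /W normcM normc_conj normc_expo mul1r.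
have zE : (\int[mu]_(x in U) (nrm2 (z_ ^~ x))%:E)%E = (ip_normsq (L2_ip D) w)%:E.
  by rewrite EFin_ip_normsq_L2// L2norm2_unit_intervals.
(* The upper frame bound makes [W j] square integrable, as Parseval's identity requires. *)
have LW j : L2 U (W j).
  apply/(L2E _ _); split => //.
  apply: (@le_lt_trans _ _ (\int[mu]_(x in U) (nrm2 (W ^~ x))%:E)%E).
    rewrite -sum_L2norm2// (bigD1 j)//= leeDl// sume_ge0// => i _.
    exact: L2norm2_ge0.
  case/andP: bW => _ /le_lt_trans; apply; rewrite zE -EFinM; exact: ltry.
have ipE j n : L2_ip D w (sys (j, n)) = L2_ip U (W j) (e n).
  rewrite /L2_ip cintegral_unit_intervals//; last first.
    by apply: cintegrable_mul_conj => //; exact: L2_exp_system.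
  congr cintegral; apply/funext => x; rewrite /W mulrAC mulr_sumr.
  apply: eq_bigr => k _; rewrite exp_system_translate !rmorphM conjcK.
  by rewrite /z_; ring.
rewrite esum_pairs; last by move=> p; rewrite lee_fin sqr_ge0.
under eq_bigr => j _ do under eq_esum => n _ do rewrite ipE.
under eq_bigr => j _ do rewrite L2_parseval//.
by rewrite sum_L2norm2// !EFinM -zE.
Qed.

Lemma exp_system_riesz_basis : riesz_basis (L2 D) (L2_ip D) sys A B.
Proof.
split => //; [exact: L2_exp_system|exact: riesz_sequence|exact: frame_bounds].
Qed.

End FrameBounds.

Theorem theorem1p2 (R : realType) (N M u : nat) (a : nat -> int)
  (hM : (2 < M)%N) (hMN : M%:R <= N%:R / 2 :> R)
  (ha0 : a 0%N = 0)
  (ha_incr : forall k : nat, (k.+1 < M)%N -> a k < a k.+1)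
  (ha_last : a M.-1 <= N%:Z - 1)
  (hu_pos : (0 < u)%N)
  (hu : u%:R >
    (if ~~ odd N then N%:R / pi * acos (M%:R * sin (1 / M%:R))
     else N%:R / pi * acos (M%:R * sin (1 / M%:R) * cos (pi / (2 * N%:R)))
          - 1 / 2) :> R)
  (ha_sep : forall k k' : nat, (k < M)%N -> (k' < M)%N -> a k <> a k' ->
    dist_int ((a k - a k')%:~R / N%:R : R)
      - dist_int ((a k - a k')%:~R * M%:R / N%:R : R) > u%:R / N%:R) :
  exists A B : R,
    riesz_basis (L2 (unit_intervals R M a)) (L2_ip (unit_intervals R M a))
      (exp_system R N M) A B
    /\ (~~ odd N ->
          M%:R * (1 - `|cos (pi * u%:R / N%:R)|) <= A
          /\ B <= M%:R * (1 + `|cos (pi * u%:R / N%:R)|))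
    /\ (odd N ->
          M%:R * (1 - `|cos (pi / (2 * N%:R) + pi * u%:R / N%:R)
                        / cos (pi / (2 * N%:R))|) <= A
          /\ B <= M%:R * (1 + `|cos (pi / (2 * N%:R) + pi * u%:R / N%:R)
                                / cos (pi / (2 * N%:R))|)).
Proof.
have N0 : (0 < N)%N.
  rewrite -(ltr_nat R); have : (0 : R) < M%:R by rewrite ltr0n; exact: leq_trans hM.
  by lra.
have ov0 := overlap_ge0 hM N0 hu_pos ha_incr ha_sep.
exists (M%:R * (1 - overlap R N u)), (M%:R * (1 + overlap R N u)); split.
  exact: exp_system_riesz_basis.
(* The constants are M (1 - rho) and M (1 + rho) themselves; as rho is nonnegative, the absolute
   values in the claimed bounds disappear. *)
move: ov0; rewrite /overlap /parity_gap; split => oN; move: ov0.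
  rewrite (negbTE oN) mulr0 add0r cos0 divr1 => ov0.
  by rewrite (ger0_norm ov0).
rewrite oN mulrA mulr1 => ov0.
by rewrite (ger0_norm ov0).
Qed.
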